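(* For all integers $k\geq 1$ and $D\geq 1$ there is a constant $K=K(k,D)$ such that the following holds. Let $\mathcal{C}$ be a finite set of $n$ irreducible algebraic curves in $\mathbb{C}^2$, each of degree at most $D$. Then $$\sum_{p\in\mathbb{C}^2} m_{k,\mathcal{C}}(p)\leq K\, n^{\frac{k+2}{k+1}}.$$
   Context: A (complex plane) algebraic curve is a set $\gamma=\{(x,y)\in\mathbb{C}^2 : P(x,y)=0\}$ with $P\in\mathbb{C}[x,y]$ a non-zero (non-constant) polynomial. One can always choose $P$ square-free; then the degree of $\gamma$ is $\deg P$, and a point $p\in\gamma$ is called smooth if $\nabla P(p)\neq 0$. Tangency to order $\geq k$: let $\gamma,\tilde\gamma$ be algebraic curves in $\mathbb{C}^2$ and let $p=(x,y)$ be a smooth point of both $\gamma$ and $\tilde\gamma$. Applying a rotation if necessary, assume that neither curve has vertical tangent at $p$. In a neighborhood of $p$, parameterize $\gamma$ as $(t,h(t))$ and $\tilde\gamma$ as $(t,\tilde h(t))$, with $h,\tilde h$ holomorphic near $x$. Then $\gamma$ and $\tilde\gamma$ are tangent at $p$ to order $\geq k$ if $|h(t)-\tilde h(t)|=O(|t-x|^{k+1})$ as $t\to x$ (equivalently, $h^{(j)}(x)=\tilde h^{(j)}(x)$ for $j=0,1,\ldots,k$). Tangency is only defined at points that are smooth on both curves. For a set $\mathcal{C}$ of irreducible algebraic curves in $\mathbb{C}^2$, an integer $k\geq 1$ and $p\in\mathbb{C}^2$, define $$m_{k,\mathcal{C}}(p)=\big|\{\gamma\in\mathcal{C} : \text{there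 exists } \tilde\gamma\in\mathcal{C} \text{ with } \tilde\gamma\neq\gamma \text{ such that } \gamma \text{ and } \tilde\gamma \text{ are tangent to order}\geq k \text{ at } p\}\big|.$$ *)

(* Defs.v *)
From mathcomp Require Import all_boot all_order all_algebra.
From mathcomp Require Import finmap.
From mathcomp Require Import all_classical all_reals all_analysis.
From mathcomp Require Import complex.
(* The notations of mpoly clash with those of analysis. *)
From mathcomp Require Import -(notations) mpoly.

Set Implicit Arguments.
Unset Strict Implicit.
Unset Printing Implicit Defensive.

Import Order.TTheory GRing.Theory Num.Theory.
Import numFieldNormedType.Exports.

Local Open Scope classical_set_scope.
Local Open Scope ring_scope.
Local Open Scope complex_scope.

Section Polynomials.
Variable A : idomainType.

Definition irreducible_elt (a : A) : Prop :=
  [/\ a != 0, a \isn't a GRing.unit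
    & forall b c : A, a = b * c -> b \is a GRing.unit \/ c \is a GRing.unit].

Definition squarefree (a : A) : Prop :=
  forall b c : A, a = b ^+ 2 * c -> b \is a GRing.unit.

End Polynomials.

(* The tag ^o selects the normed-module structure of the complex numbers
   over themselves, so that [derivable] below is complex differentiability. *)
Notation plane R := (R[i]^o * R[i]^o)%type.

Notation bipoly R := (mpoly.mpoly 2 R[i]).

Section Curves.
Variable R : realType.

Definition bieval (P : bipoly R) (p : plane R) : R[i] :=
  mpoly.meval (fun j : 'I_2 => if j == 0 then p.1 else p.2) P.

Definition dx (P : bipoly R) : bipoly R := mpoly.mderiv (0 : 'I_2) P.
Definition dy (P : bipoly R) : bipoly R := mpoly.mderiv (1 : 'I_2) P.

(* [mpoly.msize P] is the total degree plus one, and 0 for [P = 0]. *)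
Definition nonconstant (P : bipoly R) : Prop := (1 < mpoly.msize P)%N.

Definition zeros (P : bipoly R) : set (plane R) := [set p | bieval P p = 0].

Definition reduced_equation (g : set (plane R)) (P : bipoly R) : Prop :=
  [/\ nonconstant P, squarefree P & g = zeros P].

Definition irreducible_curve (g : set (plane R)) : Prop :=
  exists2 P : bipoly R, irreducible_elt P & g = zeros P.

Definition curve_degree_le (D : nat) (g : set (plane R)) : Prop :=
  exists2 P : bipoly R, reduced_equation g P & (mpoly.msize P <= D.+1)%N.

(* Reduced equations of a curve differ by a nonzero scalar, so that it does
   not matter which one is used here or in [nonvertical_at]. *)
Definition smooth_at (g : set (plane R)) (p : plane R) : Prop :=
  g p /\ exists2 P : bipoly R, reduced_equation g P
         & (bieval (dx P) p, bieval (dy P) p) <> (0, 0).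

Definition nonvertical_at (g : set (plane R)) (p : plane R) : Prop :=
  exists2 P : bipoly R, reduced_equation g P & bieval (dy P) p <> 0.

Definition holomorphic_near (x : R[i]^o) (h : R[i]^o -> R[i]^o) : Prop :=
  \forall t \near x, derivable h t 1.

Definition local_graph (g : set (plane R)) (p : plane R)
    (h : R[i]^o -> R[i]^o) : Prop :=
  holomorphic_near p.1 h /\ \forall q \near p, g q <-> q.2 = h q.1.

(* The element of SU(2) with first column (a, b), when |a|^2 + |b|^2 = 1;
   real a and b give the usual rotations. *)
Definition rotation (a b : R[i]) (p : plane R) : plane R :=
  (a * p.1 - b^* * p.2, b * p.1 + a^* * p.2).

Definition graph_tangent (k : nat) (g g' : set (plane R)) (p : plane R) : Prop :=
  exists h h' : R[i]^o -> R[i]^o,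
    [/\ local_graph g p h, local_graph g' p h'
      & (fun t => h t - h' t) =O_ (p.1) (fun t => (t - p.1) ^+ k.+1)].

(* The order of contact is invariant under linear changes of coordinates, so
   any two admissible rotations give the same notion. *)
Definition tangent (k : nat) (g g' : set (plane R)) (p : plane R) : Prop :=
  [/\ smooth_at g p, smooth_at g' p
    & exists a b : R[i],
        let r := rotation a b in
        [/\ `|a| ^+ 2 + `|b| ^+ 2 = 1,
            nonvertical_at (r @` g) (r p),
            nonvertical_at (r @` g') (r p)
          & graph_tangent k (r @` g) (r @` g') (r p)]].

Definition tangency_count (k : nat) (C : {fset set (plane R)}) (p : plane R) :
    nat :=
  #|` [fset g in C | `[< exists g' : set (plane R),
         [/\ g' \in C, g' <> g & tangent k g g' p] >]]%fset |.

End Curves.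

(* Main.v *)
(* Lift a curve P(x, y) = 0 to its k-jets (x, y, y', ..., y^(k)), where the
   derivatives are rational functions on the curve. Given n curves, linear
   algebra yields a nonzero polynomial Q in k + 2 variables, of degree
   O(n^(1/(k+1))), vanishing on all the lifts; take it of minimal degree and
   let y^(j) be the last derivative on which it depends. Where two of the curves
   are tangent to order >= k, Taylor's formula shows that the partial derivative
   of Q in y^(j) vanishes at the common jet. By minimality that derivative does
   not vanish on the whole lift of some curve, and by Bezout this curve has only
   O(n^(1/(k+1))) tangencies with the others. Remove it and repeat: at each point
   contact of order >= k is an equivalence relation, so the removal loses, at each
   tangency point of the curve, the curve itself and at most one further curve.
   Points with vertical tangent are O(1) per curve and are counted apart, which
   also accounts for the vertical lines. *)
Require Import Defs.
From mathcomp Require Import all_boot all_order all_algebra.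
From mathcomp Require Import finmap.
From mathcomp Require Import all_classical all_reals all_analysis.
From mathcomp Require Import complex.
From mathcomp Require Import perm ring lra zify.
From mathcomp Require Import -(notations) mpoly.

Set Implicit Arguments.
Unset Strict Implicit.
Unset Printing Implicit Defensive.
Import Order.TTheory GRing.Theory Num.Theory.
Import numFieldNormedType.Exports.
Local Open Scope classical_set_scope.
Local Open Scope ring_scope.

(** * Elimination in F[x][y] *)

(** The exponent comes from a count of parameters. Polynomials with all k + 2 partial degrees below
    [d] form a space of dimension d^(k+2). Vanishing on one lift costs O(d) linear conditions, as
    the pullback to the curve has bidegree O(d) and is tested at O(d) points. So n curves are
    affordable once d^(k+1) exceeds a constant times n. The obstacle is that tangency is analytic
    and stated after a rotation, while the count is algebraic in fixed coordinates. The bridge uses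
    distances alone: arbitrarily near p there are points of the two curves at mutual distance
    O(m^(k+1)), where m is the distance to p. Up to constants this is insensitive to rotations. It
    yields parallel gradients and, at nonvertical points, a common solution of both equations modulo
    (x - x0)^(k+1). Branches are such truncated polynomials, obtained by Hensel lifting. A nonzero
    eliminant of two distinct curves bounds their order of contact and tells how far to lift. *)

Section PlaneAlgebra.
Variable F : numClosedFieldType.
Implicit Types (P Q G : {poly {poly F}}) (x y : F).

(* [P : {poly {poly F}}] stands for P(x, y), the inner variable being x. *)
Definition eval2 P x y : F := P.[y%:P].[x].

(** Divisibility in F[x][y] itself; [dvdp] over the ring F[x] expresses divisibility over F(x), and
    Gauss's lemma links the two. *)
Definition divides P G : Prop := exists S, G = S * P.

Definition bidegree_le n P : Prop :=
  (size P <= n.+1)%N /\ forall i, (size (P`_i)%R <= n.+1)%N.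

Definition specialize x P : {poly F} := map_poly (horner_eval x) P.

Lemma eval2_specialize P x y : eval2 P x y = (specialize x P).[y].
Proof.
rewrite /eval2 /specialize -[LHS]/(horner_eval x P.[y%:P]).
by rewrite -horner_map /= /horner_eval hornerC.
Qed.

Lemma eval2_0 x y : eval2 0 x y = 0.
Proof. by rewrite /eval2 !horner0. Qed.

Lemma eval2D P Q x y : eval2 (P + Q) x y = eval2 P x y + eval2 Q x y.
Proof. by rewrite /eval2 !hornerD. Qed.

Lemma eval2M P Q x y : eval2 (P * Q) x y = eval2 P x y * eval2 Q x y.
Proof. by rewrite /eval2 !hornerM. Qed.

Lemma eval2C c x y : eval2 c%:P x y = c.[x].
Proof. by rewrite /eval2 hornerC. Qed.

Lemma dividesMl P Q G : divides P G -> divides P (Q * G).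
Proof. by case=> S ->; exists (Q * S); rewrite mulrA. Qed.

Lemma dividesD P Q G : divides P Q -> divides P G -> divides P (Q + G).
Proof. by case=> S -> [T ->]; exists (S + T); rewrite mulrDl. Qed.

Lemma divides0 P : divides P 0.
Proof. by exists 0; rewrite mul0r. Qed.

Lemma divides_size P G : divides P G -> G != 0 -> (size P <= size G)%N.
Proof.
case=> S ->; rewrite mulf_eq0 negb_or => /andP[S0 P0].
rewrite size_mul // -subn1 -addnBAC ?size_poly_gt0 // leq_addl //.
Qed.

Lemma unit_bipoly_size P : P \is a GRing.unit -> size P = 1%N.
Proof. by rewrite poly_unitE => /andP[/eqP]. Qed.

Lemma XsubC_dvd x P : specialize x P = 0 -> exists Q, P = ('X - x%:P)%:P * Q.
Proof.
move=> h; exists (map_poly (fun c => c %/ ('X - x%:P)) P).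
apply/polyP=> i; rewrite coefCM coef_map_id0 ?div0p //.
rewrite mulrC divpK // dvdp_XsubCl /root.
by have /(congr1 (fun p : {poly F} => p`_i)) := h; rewrite coef_map coef0 /= => /eqP.
Qed.

(** Gauss's lemma, removing the roots of [c] one at a time: at a root a, the specializations of [Q]
    and [G] at x = a have product 0 in the domain F[y], so x - a divides one of the two. *)
Lemma Gauss_factor (c : {poly F}) P Q G : c != 0 -> c%:P * P = Q * G ->
  exists Q' G' c1 c2,
    [/\ P = Q' * G', Q = c1%:P * Q', G = c2%:P * G', c1 != 0 & c2 != 0].
Proof.
have [n] := ubnP (size c); elim: n c Q G => // n IH c Q G.
rewrite ltnS => szc c0 E.
have [sz1|/closed_rootP[a ra]] := altP (size c =P 1%N).
  have /size_poly1P[u u0 cE] : size c == 1%N by apply/eqP.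
  have uV : (u^-1)%:P * u%:P = 1 :> {poly F} by rewrite -polyCM mulVf.
  exists ((u^-1)%:P%:P * Q), G, c, 1; split; rewrite ?oner_neq0 ?mul1r //.
    by rewrite -mulrA -E cE mulrA -polyCM uV mul1r.
  by rewrite cE mulrA -polyCM [u%:P * _]mulrC uV mul1r.
have Xa0 : 'X - a%:P != 0 :> {poly F} by rewrite polyXsubC_eq0.
have Xa0' : ('X - a%:P)%:P != 0 :> {poly {poly F}} by rewrite polyC_eq0.
have /factor_theorem[c' cE] := ra.
have c'0 : c' != 0 by apply: contraNneq c0 => c'0; rewrite cE c'0 mul0r.
have szc' : (size c' < n)%N.
  by apply: leq_trans szc; rewrite cE size_Mmonic ?monicXsubC // size_XsubC addn2.
have : specialize a Q * specialize a G = 0.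
  rewrite /specialize -rmorphM -E rmorphM /= map_polyC /= /horner_eval.
  by rewrite (rootP ra) polyC0 mul0r.
move/eqP; rewrite mulf_eq0 => /orP[] /eqP/XsubC_dvd[S SE].
- have /IH : c'%:P * P = S * G.
    by apply: (mulfI Xa0'); rewrite mulrA -polyCM [_ * c']mulrC -cE E SE; ring.
  case=> // Q' [G' [c1 [c2 [-> eQ eG c10 c20]]]].
  exists Q', G', (('X - a%:P) * c1), c2; split=> //; last by rewrite mulf_neq0.
  by rewrite SE eQ polyCM mulrA.
- have /IH : c'%:P * P = Q * S.
    by apply: (mulfI Xa0'); rewrite mulrA -polyCM [_ * c']mulrC -cE E SE; ring.
  case=> // Q' [G' [c1 [c2 [-> eQ eG c10 c20]]]].
  exists Q', G', c1, (('X - a%:P) * c2); split=> //; last by rewrite mulf_neq0.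
  by rewrite SE eG polyCM mulrA.
Qed.

Lemma irreducible_factor P Q G : irreducible_elt P -> P = Q * G ->
  Q \is a GRing.unit \/ G \is a GRing.unit.
Proof. by case=> _ _; apply. Qed.

Lemma irreducible_specialize P x :
  irreducible_elt P -> (1 < size P)%N -> specialize x P != 0.
Proof.
case=> _ _ irrP szP; apply/negP => /eqP /XsubC_dvd[Q PE].
have [] := irrP _ _ PE.
  rewrite poly_unitE => /andP[_]; rewrite coefC eqxx poly_unitE size_XsubC //.
move/unit_bipoly_size => szQ; move: szP.
by rewrite PE size_Cmul ?polyXsubC_eq0 // szQ.
Qed.

(** In the Gauss factorization [P] is some [c2] in F[x] times a factor of [G]; since [P] involves y,
    irreducibility makes [c2] the unit. *)
Lemma Gauss_cancel (c : {poly F}) P G : irreducible_elt P -> (1 < size P)%N ->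
  c != 0 -> divides P (c%:P * G) -> divides P G.
Proof.
move=> irrP szP c0 [S E]; have [Q' [G' [c1 [c2 [-> eQ eG c10 c20]]]]] := Gauss_factor c0 E.
have [] := irreducible_factor irrP eG; last first.
  move/unit_bipoly_size => szG; move: szP; rewrite eG size_Cmul // szG //.
move=> uc2; exists ((c2%:P)^-1 * Q'); rewrite eG mulrCA mulrA.
by rewrite -!mulrA mulVKr.
Qed.

(** When [G] involves y, [r] is the resultant: nonzero, since a common factor over F(x) would by
    Gauss's lemma make [P] divide [G]. At most M rows of the Sylvester matrix have entries of degree
    at most D, and at most D rows entries of degree at most M, hence 2DM. *)
Lemma eliminate_y P G : irreducible_elt P -> (1 < size P)%N -> ~ divides P G ->
  exists r u v, [/\ r != 0, r%:P = u * P + v * G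
    & forall D M, bidegree_le D P -> bidegree_le M G ->
        (size r <= (2 * (D * M)).+1)%N].
Proof.
move=> irrP szP ndiv.
have P0 : P != 0 by case: irrP.
have G0 : G != 0 by apply: contra_notN ndiv => /eqP ->; exact: divides0.
have [szG|szG] := leqP (size G) 1.
  exists G`_0, 0, 1; have GE := size1_polyC szG; split.
  - by rewrite -polyC_eq0 -GE.
  - by rewrite mul0r add0r mul1r -GE.
  move=> D M bP bG; apply: leq_trans (bG.2 0%N) _.
  have : (2 <= D.+1)%N by exact: leq_trans szP bP.1.
  nia.
have [[u v] _ E] := resultant_in_ideal szP szG.
exists (resultant P G), u, v; split => //.
  rewrite resultant_eq0; apply/negP => szg; apply: ndiv.
  set g := gcdp P G in szg.
  have /Pdiv.Idomain.dvdpP[[c T] /= c0 PE] := dvdp_gcdl P G.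
  have /Pdiv.Idomain.dvdpP[[c' T'] /= c'0 GE] := dvdp_gcdr P G.
  rewrite -/g -!mul_polyC in PE GE.
  have [Q' [G' [c1 [c2 [PE' eT eg c10 c20]]]]] := Gauss_factor c0 PE.
  have [uQ'|uG'] := irreducible_factor irrP PE'; last first.
    by move: szg; rewrite eg size_Cmul // (unit_bipoly_size uG').
  apply: (Gauss_cancel irrP szP c'0); rewrite GE eg.
  by exists (T' * c2%:P * Q'^-1); rewrite PE'; rewrite -!mulrA mulKr.
move=> D M bP bG; rewrite /resultant /determinant.
apply: leq_trans (size_sum _ _ _) _; apply/bigmax_leqP => s _.
rewrite -signr_odd /=; set b := odd _.
have -> : size ((-1) ^+ b * \prod_i Sylvester_mx P G i (s i)) =
          size (\prod_i Sylvester_mx P G i (s i)).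
  by case: b; rewrite ?expr1 ?expr0 ?mul1r // mulN1r size_polyN.
set e := fun i : 'I_((size G).-1 + (size P).-1) => Sylvester_mx P G i (s i).
pose d (i : 'I_((size G).-1 + (size P).-1)) := if fintype.split i is inl _ then D else M.
have ed i : (size (e i) <= (d i).+1)%N.
  rewrite /e Sylvester_mxE /d; case: (fintype.split i) => k;
  rewrite mulrb; case: ifP => _; rewrite ?size_poly0 //; [exact: bP.2|exact: bG.2].
have -> : (2 * (D * M) = M * D + D * M)%N by lia.
suff H : (size (\prod_i e i)%R <= (\sum_i d i).+1)%N.
  apply: leq_trans H _; rewrite ltnS big_split_ord /=.
  rewrite (eq_bigr (fun=> D)); last by move=> i _; rewrite /d (unsplitK (inl i)).
  rewrite [X in (_ + X)%N](eq_bigr (fun=> M)); last by move=> i _; rewrite /d (unsplitK (inr i)).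
  rewrite !sum_nat_const !card_ord.
  by apply: leq_add; apply: leq_mul => //; rewrite -ltnS prednK //; [exact: bG.1|exact: ltnW|exact: bP.1|exact: ltnW].
elim/big_ind2: _ => [|p m q n hp hq|i _]; rewrite ?size_poly1 //.
apply: leq_trans (size_polyMleq _ _) _; lia.
Qed.

Definition roots_of (p : {poly F}) : seq F := sval (closed_field_poly_normal p).

Lemma roots_ofP p : p != 0 ->
  (size (roots_of p) <= (size p).-1)%N /\ forall x, root p x -> x \in roots_of p.
Proof.
move=> p0; rewrite /roots_of; case: closed_field_poly_normal => s /= E.
rewrite E; split.
  by rewrite size_scale ?lead_coef_eq0 // size_prod_XsubC.
by move=> x; rewrite rootZ ?lead_coef_eq0 // root_prod_XsubC.
Qed.

Lemma size_specialize x P : (size (specialize x P) <= size P)%N.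
Proof. exact: size_poly. Qed.

(** Each root of the eliminant carries at most D ordinates. The bound is cruder than Bezout's, but
    linear in M, which is what the count requires. *)
Lemma weak_Bezout P G D M : irreducible_elt P -> (1 < size P)%N -> ~ divides P G ->
    bidegree_le D P -> bidegree_le M G ->
  exists2 L : seq (F * F), (size L <= 2 * (D * M) * D)%N
    & forall x y, eval2 P x y = 0 -> eval2 G x y = 0 -> (x, y) \in L.
Proof.
move=> irrP szP ndiv bP bG.
have [r [u [v [r0 E /(_ _ _ bP bG) szr]]]] := eliminate_y irrP szP ndiv.
exists (flatten [seq [seq (a, b) | b <- roots_of (specialize a P)] | a <- roots_of r]).
  have szL : (size (roots_of r) <= 2 * (D * M))%N.
    by apply: leq_trans (roots_ofP r0).1 _; case: (size r) szr.
  apply: leq_trans (leq_mul szL (leqnn D)).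
  elim: (roots_of r) => //= a s IH; rewrite size_cat size_map mulSn leq_add //.
  apply: leq_trans (roots_ofP (irreducible_specialize a irrP szP)).1 _.
  by have := leq_trans (size_specialize a P) bP.1; case: size.
move=> x y Px Gx.
have rx : r.[x] = 0.
  by rewrite -(eval2C r x y) E eval2D !eval2M Px Gx !mulr0 addr0.
apply/flatten_mapP; exists x; first by apply: (roots_ofP r0).2; exact/rootP.
apply: map_f; apply: (roots_ofP (irreducible_specialize x irrP szP)).2.
by apply/rootP; rewrite -eval2_specialize.
Qed.

(* Turns divisibility by [P] into finitely many linear conditions on [G]. *)
Lemma test_points P D : irreducible_elt P -> (1 < size P)%N -> bidegree_le D P ->
  exists f : nat -> F * F, forall M G, bidegree_le M G ->
    (forall i, eval2 P (f i).1 (f i).2 = 0 -> (i < 2 * (D * M) + D.+1)%N -> eval2 G (f i).1 (f i).2 = 0) ->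
    divides P G.
Proof.
move=> irrP szP bP; have P0 : P != 0 by case: irrP.
(* One point of the curve above each abscissa i. Where P(i, y) has no root the ordinate defaults to
   0, whence the guard on [f i] in the statement. *)
exists (fun i => (i%:R, head 0 (roots_of (specialize i%:R P)))).
move=> M G bG; set N := (_ + _)%N => van; apply: contrapT => ndiv.
have [r [u [v [r0 E /(_ _ _ bP bG) szr]]]] := eliminate_y irrP szP ndiv.
(* Fewer than N abscissae are roots of [h]. At any other one P(i, y) keeps its degree, so the chosen
   point is on the curve, and [r] would have to vanish there. *)
pose h := r * lead_coef P.
have h0 : h != 0 by rewrite mulf_neq0 ?lead_coef_eq0.
have szh : (size h <= N)%N.
  apply: leq_trans (size_polyMleq _ _) _.
  have := bP.2 (size P).-1; rewrite -/(lead_coef P) /N; lia.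
have [i iN hi] : exists2 i, (i < N)%N & h.[i%:R] != 0.
  apply: contrapT => hh.
  have := @max_poly_roots _ h [seq i%:R | i <- iota 0 N] h0.
  rewrite size_map size_iota ltnNge szh => H; suff: false by [].
  apply: H; last first.
    by rewrite map_inj_uniq ?iota_uniq // => a b /eqP; rewrite eqr_nat => /eqP.
  rewrite all_map; apply/allP => i; rewrite mem_iota add0n => /andP[_ iN] /=.
  by apply: contrapT => /negP hi; apply: hh; exists i.
move: hi; rewrite hornerM mulf_eq0 negb_or => /andP[ri li].
set y := head 0 (roots_of (specialize i%:R P)).
have Py : eval2 P i%:R y = 0.
  rewrite eval2_specialize; apply/rootP; rewrite /y /roots_of.
  case: closed_field_poly_normal => -[|b s] /= Es.
    have : size (specialize i%:R P) = size P.
      by rewrite /specialize size_map_poly_id0.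
    move=> sz; move: szP; rewrite -sz Es big_nil; move: Es; rewrite big_nil => Es.
    by rewrite alg_polyC size_polyC; case: (_ != 0).
  by rewrite Es rootZ ?lead_coef_eq0 ?irreducible_specialize // big_cons rootM root_XsubC eqxx.
have : r.[i%:R] = 0 by rewrite -(eval2C r _ y) E eval2D !eval2M Py (van i) // !mulr0 addr0.
by move/eqP; rewrite (negbTE ri).
Qed.

(** If [P] divided neither factor, the product of the two eliminants would be a nonzero multiple of
    [P] free of y, although [P] involves y. *)
Lemma irreducible_prime P Q G : irreducible_elt P -> (1 < size P)%N ->
  divides P (Q * G) -> divides P Q \/ divides P G.
Proof.
move=> irrP szP PQG; apply: contrapT => /Decidable.not_or[nQ nG].
have [r [u [v [r0 E _]]]] := eliminate_y irrP szP nQ.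
have [r' [u' [v' [r'0 E' _]]]] := eliminate_y irrP szP nG.
have : divides P (r * r')%:P.
  rewrite polyCM E E'.
  have -> : (u * P + v * Q) * (u' * P + v' * G) =
    (u * P * u' + u * v' * G + v * Q * u') * P + v * v' * (Q * G) by ring.
  by apply: dividesD; [exists (u * P * u' + u * v' * G + v * Q * u')|exact: dividesMl].
move/divides_size; rewrite polyC_eq0 mulf_neq0 // => /(_ isT).
by rewrite size_polyC mulf_neq0 // leqNgt szP.
Qed.

End PlaneAlgebra.

(** * Jets along a curve *)

Section Jets.
Variable F : numClosedFieldType.
Implicit Types (P Q G A : {poly {poly F}}) (H : {poly F}) (x y : F).

Lemma bidegree_leW m n P : (m <= n)%N -> bidegree_le m P -> bidegree_le n P.
Proof. by move=> mn [h1 h2]; split=> [|i]; apply: leq_trans (_ : m.+1 <= _)%N. Qed.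

Lemma bidegree_leD n P Q : bidegree_le n P -> bidegree_le n Q -> bidegree_le n (P + Q).
Proof.
move=> [h1 h2] [h3 h4]; split=> [|i]; rewrite ?coefD;
by apply: leq_trans (size_polyD _ _) _; rewrite geq_max ?h1 ?h2 ?h3 ?h4.
Qed.

Lemma bidegree_leN n P : bidegree_le n P -> bidegree_le n (- P).
Proof. by move=> [h1 h2]; split=> [|i]; rewrite ?coefN size_polyN. Qed.

Lemma bidegree_le0 n : bidegree_le n (0 : {poly {poly F}}).
Proof. by split=> [|i]; rewrite ?coef0 size_poly0. Qed.

Lemma bidegree_le_sum n I (r : seq I) (p : pred I) (f : I -> {poly {poly F}}) :
  (forall i, p i -> bidegree_le n (f i)) -> bidegree_le n (\sum_(i <- r | p i) f i).
Proof.
move=> h; elim/big_ind: _ => //; [exact: bidegree_le0|exact: bidegree_leD].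
Qed.

Lemma bidegree_leMn n m P : bidegree_le n P -> bidegree_le n (P *+ m).
Proof.
move=> h; elim: m => [|m IH]; first exact: bidegree_le0.
by rewrite mulrS; apply: bidegree_leD.
Qed.

Lemma bidegree_leM m n P Q :
  bidegree_le m P -> bidegree_le n Q -> bidegree_le (m + n) (P * Q).
Proof.
move=> [h1 h2] [h3 h4]; split=> [|i]; first by apply: leq_trans (size_polyMleq _ _) _; lia.
rewrite coefM; elim/big_ind: _ => [|p q hp hq|j _]; first by rewrite size_poly0.
  by apply: leq_trans (size_polyD _ _) _; rewrite geq_max hp hq.
apply: leq_trans (size_polyMleq _ _) _; have := h2 j; have := h4 (i - j)%N; lia.
Qed.

Lemma bidegree_leC c : bidegree_le 0 (c%:P%:P : {poly {poly F}}).
Proof.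
split=> [|i]; first by rewrite size_polyC; case: (_ != 0).
by rewrite coefC; case: eqP => _; rewrite ?size_poly0 // size_polyC; case: (_ != 0).
Qed.

Lemma bidegree_leX m n P : bidegree_le n P -> bidegree_le (m * n) (P ^+ m).
Proof.
move=> h; elim: m => [|m IH]; first exact: (bidegree_leC 1).
by rewrite exprS mulSn; apply: bidegree_leM.
Qed.

Lemma bidegree_leY : bidegree_le 1 ('X : {poly {poly F}}).
Proof.
split=> [|i]; first by rewrite size_polyX.
by rewrite coefX; case: eqP => _; rewrite ?size_poly0 // size_poly1.
Qed.

Lemma bidegree_le_x : bidegree_le 1 ('X%:P : {poly {poly F}}).
Proof.
split=> [|i]; first by rewrite size_polyC; case: (_ != 0).
by rewrite coefC; case: eqP => _; rewrite ?size_poly0 // size_polyX.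
Qed.

Definition derivx P : {poly {poly F}} := map_poly (@deriv F) P.

Lemma coef_derivx P i : (derivx P)`_i = (P`_i)^`().
Proof. by rewrite /derivx coef_map_id0 // raddf0. Qed.

Lemma derivx0 : derivx 0 = 0.
Proof. by apply/polyP=> i; rewrite coef_derivx !coef0 deriv0. Qed.

Lemma derivxD P Q : derivx (P + Q) = derivx P + derivx Q.
Proof. by apply/polyP=> i; rewrite !(coefD, coef_derivx) derivD. Qed.

Lemma derivxC (c : {poly F}) : derivx c%:P = (c^`())%:P.
Proof. by apply/polyP=> i; rewrite coef_derivx !coefC; case: (i == 0)%N; rewrite ?deriv0. Qed.

Lemma derivxX : derivx 'X = 0.
Proof. by apply/polyP=> i; rewrite coef_derivx coefX coef0; case: eqP => _; rewrite ?deriv0 // -polyC1 derivC. Qed.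

Lemma derivxMX P : derivx (P * 'X) = derivx P * 'X.
Proof.
apply/polyP=> i; rewrite coef_derivx !coefMX coef_derivx.
by case: (i == 0)%N; rewrite ?deriv0.
Qed.

Lemma derivxM P Q : derivx (P * Q) = derivx P * Q + P * derivx Q.
Proof.
elim/poly_ind: P => [|P c IH]; first by rewrite derivx0 !mul0r derivx0 addr0.
have derivxMC c' G : derivx (c'%:P * G) = (c'^`())%:P * G + c'%:P * derivx G.
  by apply/polyP=> i; rewrite coefD !coefCM !coef_derivx coefCM derivM.
by rewrite mulrDl mulrAC !derivxD !derivxMX IH derivxMC derivxC; ring.
Qed.

Lemma bidegree_le_deriv n P : bidegree_le n P -> bidegree_le n P^`().
Proof.
move=> [h1 h2]; split=> [|i].
  have [->|P0] := eqVneq P 0; first by rewrite deriv0 size_poly0.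
  by apply: leq_trans h1; apply: ltnW; apply: lt_size_deriv.
by apply: leq_trans (h2 i.+1); rewrite coef_deriv -scaler_nat size_scale_leq.
Qed.

Lemma bidegree_le_derivx n P : bidegree_le n P -> bidegree_le n (derivx P).
Proof.
move=> [h1 h2]; split=> [|i]; first exact: leq_trans (size_poly _ _) h1.
rewrite coef_derivx; have [->|p0] := eqVneq (P`_i) 0; first by rewrite deriv0 size_poly0.
by apply: leq_trans (h2 i); apply: ltnW; apply: lt_size_deriv.
Qed.

Lemma deriv_horner P H : (P.[H])^`() = (derivx P).[H] + P^`().[H] * H^`().
Proof.
elim/poly_ind: P => [|P c IH]; first by rewrite derivx0 deriv0 !horner0 mul0r addr0 deriv0.
rewrite derivxD derivxMX derivxC derivMXaddC !hornerE /= derivD derivM IH.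
by ring.
Qed.

(* [(d/dx)^i y = jetnum P i / (P_y)^(2i)] along [P = 0]; the recursion is the
   quotient rule for d/dx = (P_y d_x - P_x d_y) / P_y. *)
Definition along P A : {poly {poly F}} := P^`() * derivx A - derivx P * A^`().

Fixpoint jetnum P i : {poly {poly F}} :=
  if i is i'.+1 then
    P^`() * along P (jetnum P i') - (jetnum P i' * along P P^`()) *+ (2 * i')
  else 'X.

Lemma bidegree_le_along D a P A :
  bidegree_le D P -> bidegree_le a A -> bidegree_le (D + a) (along P A).
Proof.
move=> hP hA; apply: bidegree_leD; last apply: bidegree_leN; apply: bidegree_leM;
by [exact: bidegree_le_deriv|exact: bidegree_le_derivx].
Qed.

Lemma bidegree_jetnum D P i : bidegree_le D P -> bidegree_le (1 + 2 * D * i) (jetnum P i).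
Proof.
move=> hP; elim: i => [|i IH] /=; first by rewrite muln0 addn0; apply: bidegree_leY.
have hP' := bidegree_le_deriv hP.
apply: bidegree_leD; last apply: bidegree_leN; last apply: bidegree_leMn.
  apply: bidegree_leW (bidegree_leM hP' (bidegree_le_along hP IH)); lia.
apply: bidegree_leW (bidegree_leM IH (bidegree_le_along hP hP')); lia.
Qed.

(** * Truncated branches at an abscissa x0 *)

Section Congruence.
Variable x0 : F.
Local Notation T := ('X - x0%:P).

(** Stands for equality of power series truncated at order N; each differentiation costs one
    order. *)
Definition cong N (a b : {poly F}) : bool := T ^+ N %| a - b.

Lemma congxx N a : cong N a a.
Proof. by rewrite /cong subrr dvdp0. Qed.

Lemma cong_sym N a b : cong N a b -> cong N b a.
Proof. by rewrite /cong -(opprB a b) dvdpNr. Qed.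

Lemma cong_trans N a b c : cong N a b -> cong N b c -> cong N a c.
Proof.
move=> h1 h2; rewrite /cong; have -> : a - c = (a - b) + (b - c) by ring.
exact: dvdp_add.
Qed.

Lemma congW M N a b : (M <= N)%N -> cong N a b -> cong M a b.
Proof. by move=> MN; apply: dvdp_trans; apply: dvdp_exp2l. Qed.

Lemma congD N a b c d : cong N a b -> cong N c d -> cong N (a + c) (b + d).
Proof.
move=> h1 h2; rewrite /cong; have -> : a + c - (b + d) = (a - b) + (c - d) by ring.
exact: dvdp_add.
Qed.

Lemma congN N a b : cong N a b -> cong N (- a) (- b).
Proof. by rewrite /cong -opprD dvdpNr. Qed.

Lemma congB N a b c d : cong N a b -> cong N c d -> cong N (a - c) (b - d).
Proof. by move=> h1 h2; apply: congD => //; apply: congN. Qed.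

Lemma congMn N m a b : cong N a b -> cong N (a *+ m) (b *+ m).
Proof.
by move=> h; elim: m => [|m IH]; rewrite ?congxx // !mulrS; apply: congD.
Qed.

Lemma congM N a b c d : cong N a b -> cong N c d -> cong N (a * c) (b * d).
Proof.
move=> h1 h2; rewrite /cong; have -> : a * c - b * d = (a - b) * c + b * (c - d) by ring.
by apply: dvdp_add; [exact: dvdp_mulr|exact: dvdp_mull].
Qed.

Lemma cong_deriv N a b : cong N a b -> cong N.-1 a^`() b^`().
Proof.
case: N => [|N] /=; first by rewrite /cong expr0 !dvd1p.
rewrite /cong -derivB => /dvdpP[q ->]; rewrite derivM; apply: dvdp_add.
  by apply: dvdp_mull; apply: dvdp_exp2l.
by rewrite deriv_exp derivXsubC mul1r /= -mulr_natl; do 2!apply: dvdp_mull.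
Qed.

Lemma cong1P a b : reflect (a.[x0] = b.[x0]) (cong 1 a b).
Proof.
rewrite /cong expr1 dvdp_XsubCl /root hornerD hornerN subr_eq0; exact: eqP.
Qed.

Lemma coprime_exp_XsubC N (a : {poly F}) : a.[x0] != 0 -> coprimep (T ^+ N) a.
Proof.
by move=> a0; apply: coprimep_expl; rewrite coprimep_sym coprimep_XsubC.
Qed.

Lemma cong_mulI N a b : a.[x0] != 0 -> cong N (a * b) 0 -> cong N b 0.
Proof. by rewrite /cong !subr0 => a0; rewrite Gauss_dvdpr ?coprime_exp_XsubC. Qed.

(** On a branch y = H(x) the chain rule gives P_x = - P_y H' to order N - 1, so [along] acts as P_y
    times d/dx. *)
Lemma along_cong N P A H : cong N P.[H] 0 ->
  cong N.-1 (along P A).[H] (P^`().[H] * (A.[H])^`()).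
Proof.
move=> /cong_deriv; rewrite deriv_horner deriv0 => h.
rewrite /along deriv_horner !hornerE /=.
have -> : P^`().[H] * ((derivx A).[H] + A^`().[H] * H^`()) =
  P^`().[H] * (derivx A).[H] - (0 - P^`().[H] * H^`()) * A^`().[H] by ring.
apply: congB; rewrite ?congxx //; apply: congM; rewrite ?congxx //.
rewrite -(addrK (P^`().[H] * H^`()) (derivx P).[H]).
by apply: congB; rewrite ?congxx.
Qed.

Lemma jetnum_cong N P H i : cong N P.[H] 0 ->
  cong (N - i) (jetnum P i).[H] (P^`().[H] ^+ (2 * i) * H^`(i)).
Proof.
move=> hP; elim: i => [|i IH]; first by rewrite subn0 muln0 expr0 mul1r /= hornerX congxx.
rewrite [jetnum P i.+1]/= hornerD hornerN hornerMn !hornerM subnS.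
have hN : ((N - i).-1 <= N.-1)%N by lia.
set U := P^`().[H] in IH *.
have h1 := congW hN (along_cong (jetnum P i) hP).
have h2 := congW hN (along_cong P^`() hP).
have h3 := cong_deriv IH.
rewrite -/U in h1 h2.
(* The quotient rule cleared of denominators: on the right the two terms with the derivative of [U]
   cancel. *)
have -> : U ^+ (2 * i.+1) * H^`(i.+1) =
   U * (U * (U ^+ (2 * i) * H^`(i))^`()) - (U ^+ (2 * i) * H^`(i) * (U * U^`())) *+ (2 * i).
  rewrite derivM deriv_exp -derivnS mulnS !exprS.
  case: (2 * i)%N => [|m]; first by rewrite !mulr0n subr0 mul0r add0r; ring.
  have [c cE] : exists c : {poly F}, forall b, b *+ m.+1 = b * c.
    by exists m.+1%:R => b; rewrite mulr_natr.
  by rewrite /= !cE exprS; ring.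
apply: congB; [apply: congM; [exact: congxx|]|apply: congMn].
  apply: cong_trans h1 _; apply: congM; [exact: congxx|exact: h3].
by apply: congM h2; apply: congW IH; lia.
Qed.

Lemma taylor1 P (a e : {poly F}) : exists r, P.[a + e] = P.[a] + P^`().[a] * e + e ^+ 2 * r.
Proof.
elim/poly_ind: P => [|P c [r IH]]; first by exists 0; rewrite deriv0 !horner0; ring.
exists (P^`().[a] + r * (a + e)).
by rewrite derivMXaddC !hornerE /= IH; ring.
Qed.

Lemma horner_cong1 P H y0 : H.[x0] = y0 -> P.[H].[x0] = eval2 P x0 y0.
Proof.
move=> <-; elim/poly_ind: P => [|P c IH]; first by rewrite /eval2 !horner0.
by rewrite eval2D eval2M eval2C -IH /eval2 hornerX hornerC !hornerE.
Qed.

(** Newton's iteration, one order at a time: [c] solves q(x0) + P_y(x0, y0) c = 0, which kills the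
    lowest term of the error. The first order is treated apart, as the square of a constant
    correction is not of higher order. *)
Lemma Hensel_exists P y0 N : eval2 P x0 y0 = 0 -> eval2 P^`() x0 y0 != 0 ->
  exists2 H, H.[x0] = y0 & cong N P.[H] 0.
Proof.
move=> P0 dP0; elim: N => [|N [H Hy hH]]; first by exists y0%:P; rewrite ?hornerC // /cong expr0 dvd1p.
case: N hH => [|N] hH.
  exists y0%:P; first by rewrite hornerC.
  by apply/cong1P; rewrite horner0 -/(eval2 P x0 y0).
move: hH; rewrite /cong subr0 => /dvdpP[q Eq].
have dH : P^`().[H].[x0] != 0 by rewrite (horner_cong1 _ Hy).
set c := - q.[x0] / P^`().[H].[x0].
have [r Er] := taylor1 P H (c%:P * T ^+ N.+1).
exists (H + c%:P * T ^+ N.+1).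
  by rewrite !(hornerE, horner_exp) /= subrr expr0n mulr0 addr0.
rewrite Er Eq; have -> : q * T ^+ N.+1 + P^`().[H] * (c%:P * T ^+ N.+1) + (c%:P * T ^+ N.+1) ^+ 2 * r - 0
  = T ^+ N.+1 * (q + P^`().[H] * c%:P) + T ^+ N.+2 * (c%:P ^+ 2 * T ^+ N * r).
  by rewrite !exprS; ring.
apply: dvdp_add; last exact: dvdp_mulr.
rewrite [T ^+ N.+2]exprSr dvdp_mul //.
have dc : P^`().[H].[x0] * c = - q.[x0] by rewrite /c mulrCA divff // mulr1.
by rewrite dvdp_XsubCl /root hornerD hornerM hornerC dc subrr.
Qed.

(** P(H') - P(H) is H' - H times a factor whose value at x0 is P_y(x0, y0), hence prime to x -
    x0. *)
Lemma Hensel_unique P y0 N H H' : eval2 P^`() x0 y0 != 0 ->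
    H.[x0] = y0 -> H'.[x0] = y0 -> cong N P.[H] 0 -> cong N P.[H'] 0 ->
  cong N H' H.
Proof.
move=> dP Hy Hy' h h'; have [r E] := taylor1 P H (H' - H).
rewrite subrKC in E.
have : cong N ((P^`().[H] + (H' - H) * r) * (H' - H)) 0.
  have -> : (P^`().[H] + (H' - H) * r) * (H' - H) = P.[H'] - P.[H] by rewrite E; ring.
  by rewrite -(subr0 0); apply: congB.
move/cong_mulI; rewrite /cong subr0; apply.
by rewrite !hornerE /= (horner_cong1 _ Hy) Hy Hy' subrr mul0r addr0.
Qed.

End Congruence.
End Jets.

(** * Contact of two curves *)

Section Lifting.
Variables (F : numClosedFieldType) (k : nat).
Implicit Types (P G : {poly {poly F}}) (H : {poly F}) (Q : mpoly k.+2 F).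

(* The variable 0 of [Q] is x, the variable i.+1 is the i-th derivative of y. *)
Definition lift_scale P : {poly {poly F}} := P^`() ^+ (2 * k).

Definition lift_coord P (i : 'I_k.+2) : {poly {poly F}} :=
  if (i : nat) is i'.+1 then jetnum P i' * P^`() ^+ (2 * (k - i'))
  else 'X%:P * lift_scale P.

(* [Q] at the k-jet of the curve, times [(P_y)^(2kE)] to clear denominators. *)
Definition pullback E P Q : {poly {poly F}} :=
  \sum_(m <- msupp Q) (mcoeff m Q)%:P%:P *
    (lift_scale P ^+ (E - mdeg m) * \prod_(i < k.+2) lift_coord P i ^+ (m i : nat)).

Lemma mmap1_scale (S : comNzRingType) (w : S) (v : 'I_k.+2 -> S) m :
  mmap1 (fun i => w * v i) m = w ^+ mdeg m * mmap1 v m.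
Proof.
rewrite /mmap1 mdegE -prodrXr -big_split /=.
by apply: eq_bigr => i _; rewrite exprMn.
Qed.

Section Rel.
Variables (S : comNzRingType) (theta : {rmorphism {poly {poly F}} -> S}).
Variables (rel : S -> S -> Prop).
Hypotheses (relxx : forall a, rel a a).
Hypotheses (relD : forall a b c d, rel a b -> rel c d -> rel (a + c) (b + d)).
Hypotheses (relM : forall a b c d, rel a b -> rel c d -> rel (a * c) (b * d)).

(** Abstract in the relation because it serves twice: with congruence along a branch, [theta]
    substituting [H] for y, and with equality at a point, [theta] being evaluation. *)
Lemma pullback_rel E P Q (v : 'I_k.+2 -> S) : (msize Q <= E.+1)%N ->
  (forall i, rel (theta (lift_coord P i)) (theta (lift_scale P) * v i)) ->
  rel (theta (pullback E P Q))
      (theta (lift_scale P) ^+ E * mmap (fun c => theta c%:P%:P) v Q).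
Proof.
move=> sQ hv; rewrite /pullback rmorph_sum /mmap big_distrr /=.
rewrite big_seq [X in rel _ X]big_seq.
apply: (big_ind2 rel) => [||m hm]; [exact: relxx|by move=> *; exact: relD|].
have mE : (mdeg m <= E)%N by have := leq_trans (msize_mdeg_lt hm) sQ.
rewrite !rmorphM /= [X in rel _ X]mulrCA; apply: relM; first exact: relxx.
rewrite -{2}(subnK mE) exprD -mulrA -mmap1_scale rmorphXn /=.
apply: relM; first exact: relxx.
rewrite rmorph_prod /mmap1; apply: (big_ind2 rel) => [||i _]; [exact: relxx|by move=> *; exact: relM|].
rewrite rmorphXn /=; elim: (m i : nat) => [|e IH]; first by rewrite !expr0.
by rewrite !exprS; apply: relM.
Qed.
End Rel.

Lemma bidegree_pullback D E P Q : bidegree_le D P -> (msize Q <= E.+1)%N ->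
  bidegree_le ((1 + 2 * D * k) * E) (pullback E P Q).
Proof.
move=> bP sQ; set c := (1 + 2 * D * k)%N.
have bP' := bidegree_le_deriv bP.
have bW : bidegree_le c (lift_scale P).
  by apply: bidegree_leW (bidegree_leX (2 * k) bP'); rewrite /c; lia.
have bB i : bidegree_le c (lift_coord P i).
  rewrite /lift_coord; case: i => -[|i] /= hi.
    by apply: bidegree_leW (bidegree_leM (bidegree_le_x _) (bidegree_leX (2 * k) bP')); rewrite /c; lia.
  apply: bidegree_leW (bidegree_leM (bidegree_jetnum i bP) (bidegree_leX (2 * (k - i)) bP')).
  rewrite /c; nia.
rewrite /pullback big_seq; apply: bidegree_le_sum => m hm.
have mE : (mdeg m <= E)%N by have := leq_trans (msize_mdeg_lt hm) sQ.
rewrite -[X in bidegree_le X]add0n; apply: bidegree_leM; first exact: bidegree_leC.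
have -> : (c * E = (E - mdeg m) * c + mdeg m * c)%N by rewrite -mulnDl subnK // mulnC.
apply: bidegree_leM; first exact: bidegree_leX.
rewrite mdegE big_distrl /=.
elim/big_ind2: _ => [|n1 P1 n2 P2|i _]; [exact: (bidegree_leC 1)|exact: bidegree_leM|].
exact: bidegree_leX.
Qed.

Definition jet_of H (i : 'I_k.+2) : {poly F} := if (i : nat) is i'.+1 then H^`(i') else 'X.

Lemma pullback_cong x0 N E P Q H : (msize Q <= E.+1)%N -> cong x0 N P.[H] 0 ->
  cong x0 (N - k) (pullback E P Q).[H]
    ((lift_scale P).[H] ^+ E * mmap polyC (jet_of H) Q).
Proof.
move=> sQ hP.
have := @pullback_rel _ (horner_eval H) (fun a b => cong x0 (N - k) a b)
  (congxx _ _) (@congD _ _ _) (@congM _ _ _) E P Q (jet_of H) sQ.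
rewrite /= /horner_eval.
have -> : mmap (fun c : F => (c%:P%:P).[H]) (jet_of H) Q = mmap polyC (jet_of H) Q.
  by apply: eq_bigr => m _; rewrite hornerC.
apply => i; rewrite /lift_coord /jet_of /lift_scale; case: i => -[|i] /= hi.
  by rewrite hornerM hornerC mulrC congxx.
rewrite hornerM !horner_exp; have ik : (i <= k)%N by [].
rewrite -{3}(subnK ik) mulnDr exprD -mulrA mulrC; apply: congM; first exact: congxx.
by apply: congW (jetnum_cong i hP); rewrite leq_sub2l.
Qed.

Lemma mderiv0_supp Q i m : mderiv i Q = 0 -> m \in msupp Q -> m i = 0%N.
Proof.
move=> dQ hm; apply/eqP; apply: contraT => mi.
have := mcoeff_deriv i (mnm_sub m (mnm1 i)) Q.
rewrite dQ mcoeff0 submK; last by apply/mnm_lepP => l; rewrite mnm1E; case: eqP => // <-; rewrite lt0n.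
move=> /eqP; rewrite eq_sym mulrn_eq0 /= => /eqP h.
by move: hm; rewrite mcoeff_msupp h eqxx.
Qed.

Lemma mmap_indep (S : comNzRingType) (f : F -> S) (v v' : 'I_k.+2 -> S) Q :
  (forall i, v i = v' i \/ mderiv i Q = 0) -> mmap f v Q = mmap f v' Q.
Proof.
move=> h; rewrite /mmap big_seq [RHS]big_seq; apply: eq_bigr => m hm.
congr (_ * _); apply: eq_bigr => i _; case: (h i) => [->//|dQ].
by rewrite (mderiv0_supp dQ hm) !expr0.
Qed.

Lemma mpoly_ring_ind (p : mpoly k.+2 F -> Prop) :
    (forall c, p (mpolyC _ c)) -> (forall i, p (mpolyX F (mnm1 i))) ->
    (forall Q R, p Q -> p R -> p (Q + R)) -> (forall Q R, p Q -> p R -> p (Q * R)) ->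
  forall Q, p Q.
Proof.
move=> pC pX pD pM; elim/mpolyind => [|c m Q _ _ hQ].
  by have := pC 0; rewrite mpolyC0.
apply: (pD) => //; rewrite -mul_mpolyC; apply: (pM) => //.
rewrite mpolyXE_id; apply: (big_ind p) => [||i _]; [exact: (pC 1)|exact: pM|].
by elim: (m i : nat) => [|e IH]; [exact: (pC 1)|rewrite exprS; exact: pM].
Qed.

Lemma mmap_polyCM (v : 'I_k.+2 -> {poly F}) :
  {morph mmap polyC v : Q R / Q * R >-> Q * R}.
Proof. exact: rmorphM. Qed.

(** True for constants and variables, and stable under sums and products: the error of a product
    combines the two errors and the product of the increments, divisible by [d ^+ 2]. *)
Lemma mpoly_taylor (d : {poly F}) (v w : 'I_k.+2 -> {poly F}) Q :
  (forall i, d %| w i) ->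
  d ^+ 2 %| mmap polyC (fun i => v i + w i) Q - mmap polyC v Q
            - \sum_i mmap polyC v (mderiv i Q) * w i.
Proof.
move=> dw; elim/mpoly_ring_ind: Q => [c|i|Q R hQ hR|Q R hQ hR].
- rewrite !mmapC subrr big1 ?subr0 ?dvdp0 // => i _.
  by rewrite mderivC mmap0 mul0r.
- rewrite !mmapX !mmap1U (bigD1 i) //= big1 ?addr0.
    have -> : mderiv i (mpolyX F (mnm1 i)) = mpolyC _ 1.
      rewrite mderivX mnm1E eqxx scale1r mpolyC1 -mpolyX0; congr mpolyX.
      by apply/mnmP => l; rewrite mnmBE mnm0E subnn.
    rewrite mmapC mul1r /=.
    by rewrite (_ : v i + w i - v i - w i = 0) ?dvdp0 //; ring.
  by move=> j ji; rewrite mderivX mnm1E eq_sym (negbTE ji) scale0r mmap0 mul0r.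
- have -> : mmap polyC (fun i => v i + w i) (Q + R) - mmap polyC v (Q + R)
            - \sum_i mmap polyC v (mderiv i (Q + R)) * w i =
    (mmap polyC (fun i => v i + w i) Q - mmap polyC v Q
            - \sum_i mmap polyC v (mderiv i Q) * w i) +
    (mmap polyC (fun i => v i + w i) R - mmap polyC v R
            - \sum_i mmap polyC v (mderiv i R) * w i).
    rewrite !mmapD (eq_bigr (fun i => mmap polyC v (mderiv i Q) * w i +
      mmap polyC v (mderiv i R) * w i)); last by move=> i _; rewrite mderivD mmapD mulrDl.
    by rewrite big_split /=; ring.
  exact: dvdp_add.
have dsum (G : mpoly k.+2 F) : d %| \sum_i mmap polyC v (mderiv i G) * w i.
  by apply: (big_ind (fun a => d %| a)) => [||i _]; [exact: dvdp0|move=> *; exact: dvdp_add|exact: dvdp_mull].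
have ddiff (G : mpoly k.+2 F) : d ^+ 2 %| mmap polyC (fun i => v i + w i) G - mmap polyC v G
            - \sum_i mmap polyC v (mderiv i G) * w i ->
   d %| mmap polyC (fun i => v i + w i) G - mmap polyC v G.
  move=> h; rewrite -(subrK (\sum_i mmap polyC v (mderiv i G) * w i) (_ - _)).
  apply: dvdp_add (dsum G); apply: dvdp_trans h; rewrite expr2; exact: dvdp_mulr.
rewrite !mmap_polyCM.
set a := mmap _ _ Q in hQ *; set b := mmap _ _ R in hR *.
set a' := mmap _ v Q in hQ *; set b' := mmap _ v R in hR *.
have -> : a * b - a' * b' - \sum_i mmap polyC v (mderiv i (Q * R)) * w i =
  (a - a' - \sum_i mmap polyC v (mderiv i Q) * w i) * b' +
  a' * (b - b' - \sum_i mmap polyC v (mderiv i R) * w i) + (a - a') * (b - b').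
  rewrite (eq_bigr (fun i => mmap polyC v (mderiv i Q) * w i * b' +
      a' * (mmap polyC v (mderiv i R) * w i))); last first.
    by move=> i _; rewrite mderivM mmapD !mmap_polyCM; ring.
  by rewrite big_split /= -big_distrl -big_distrr /=; ring.
apply: dvdp_add; last by rewrite expr2; apply: dvdp_mul; [exact: ddiff hQ|exact: ddiff hR].
by apply: dvdp_add; [exact: dvdp_mulr|exact: dvdp_mull].
Qed.

(** The formal counterpart of tangency where neither tangent is vertical: [H] carries the common
    k-jet. *)
Definition contact P P' x0 y0 : Prop :=
  [/\ eval2 P x0 y0 = 0, eval2 P' x0 y0 = 0,
      eval2 P^`() x0 y0 != 0, eval2 P'^`() x0 y0 != 0
    & exists2 H, H.[x0] = y0 & cong x0 k.+1 P.[H] 0 /\ cong x0 k.+1 P'.[H] 0].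

Lemma contact_sym P P' x0 y0 : contact P P' x0 y0 -> contact P' P x0 y0.
Proof. by case=> h1 h2 h3 h4 [H h5 [h6 h7]]; split=> //; exists H. Qed.

(** Both given branches are branches of the middle curve through the same point, so uniqueness
    identifies them to order k + 1. *)
Lemma contact_trans P P' P'' x0 y0 :
  contact P P' x0 y0 -> contact P' P'' x0 y0 -> contact P P'' x0 y0.
Proof.
case=> h1 h2 h3 h4 [H h5 [h6 h7]] [g1 g2 g3 g4 [H' g5 [g6 g7]]]; split=> //.
exists H => //; split=> //; have := Hensel_unique h4 g5 h5 g6 h7.
rewrite /cong => HH'; have [r E] := taylor1 P'' H' (H - H').
rewrite subrKC in E; rewrite E subr0 -addrA; apply: dvdp_add.
  by move: g7; rewrite /cong subr0.
by apply: dvdp_add; [exact: dvdp_mull|rewrite expr2 -mulrA; exact: dvdp_mulr].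
Qed.

(** The value at x0 is recorded because the falling factorial is nonzero in characteristic 0: if [g]
    does not vanish at x0, each derivation lowers the order by exactly one. *)
Lemma derivn_mul_XsubCn (x0 : F) (g : {poly F}) L i : (i <= L)%N ->
  exists2 g', (g * ('X - x0%:P) ^+ L)^`(i) = g' * ('X - x0%:P) ^+ (L - i)
    & g'.[x0] = g.[x0] *+ (L ^_ i).
Proof.
elim: i => [|i IH] iL; first by exists g; rewrite ?subn0.
have [g' E gx] := IH (ltnW iL); rewrite derivnS E.
exists (g'^`() * ('X - x0%:P) + g' *+ (L - i)).
  rewrite derivM deriv_exp derivXsubC mul1r subnS.
  case: (L - i)%N (subn_gt0 i L) => [|n _]; first by rewrite iL.
  rewrite succnK; move: ('X - x0%:P) => T.
  by rewrite exprS mulrDl -mulrA mulrnAl mulrnAr.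
by rewrite hornerD hornerM hornerXsubC subrr mulr0 add0r hornerMn gx -mulrnA ffactnSr mulnC.
Qed.

(* If y and y' have contact of order exactly l >= k, the difference of their
   j-th derivatives vanishes to the order l + 1 - j only, that of all the
   lower derivatives to a higher order; Taylor's formula for [Q], which
   vanishes along both jets, then shows that its partial derivative in the
   highest variable vanishes at the common jet. *)
Lemma contact_top_derivative P P' x0 y0 Q E (j : 'I_k.+2) :
    irreducible_elt P -> (1 < size P)%N -> ~ divides P P' ->
    contact P P' x0 y0 -> (msize Q <= E.+1)%N ->
    divides P (pullback E P Q) -> divides P' (pullback E P' Q) ->
    (0 < j)%N -> (forall i : 'I_k.+2, (j < i)%N -> mderiv i Q = 0) ->
    (msize (mderiv j Q) <= E.+1)%N ->
  eval2 (pullback E P (mderiv j Q)) x0 y0 = 0.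
Proof.
move=> irrP szP ndiv [P0 P'0 dP dP' [H Hy [HP HP']]] sQ dvP dvP' j0 hj sQj.
have [r [u [v [r0 rE _]]]] := eliminate_y irrP szP ndiv.
(* Contact has bounded order: were the branches equal modulo (x - x0)^R, this power would divide
   [r], of degree below R. Lifting to order R + k + 1 leaves R + 1 after k derivations. *)
set R := size r; have R0 : (0 < R)%N by rewrite size_poly_gt0.
have [H1 H1y H1P] := Hensel_exists (R + k).+1 P0 dP.
have [H2 H2y H2P] := Hensel_exists (R + k).+1 P'0 dP'.
set N := (R + k).+1 in H1P H2P.
have kN : (k.+1 <= N)%N by rewrite ltnS leq_addl.
have RN : (R <= N)%N by rewrite leqW // leq_addr.
have Nk : (N - k)%N = R.+1 by rewrite subSn ?leq_addl // addnK.
have H1H := Hensel_unique dP Hy H1y HP (congW kN H1P).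
have H2H := Hensel_unique dP' Hy H2y HP' (congW kN H2P).
have H21 : cong x0 k.+1 H2 H1 by exact: cong_trans H2H (cong_sym H1H).
pose G := H2 - H1; pose T := 'X - x0%:P.
have nG M : T ^+ M %| G -> (M <= R.-1)%N.
  move=> hG; rewrite leqNgt; apply/negP => MR.
  have hR : (R <= M)%N by lia.
  have hG' : cong x0 R H2 H1 by apply: congW hR hG.
  have P'1 : cong x0 R P'.[H1] 0.
    have [q Eq] := taylor1 P' H2 (H1 - H2); rewrite subrKC in Eq.
    rewrite -(subr0 0) Eq /cong subr0 subr0 -addrA; apply: dvdp_add.
      by have := congW RN H2P; rewrite /cong subr0.
    have := cong_sym hG'; rewrite /cong => h; apply: dvdp_add; first exact: dvdp_mull.
    by rewrite expr2 -mulrA; apply: dvdp_mulr.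
  have : T ^+ R %| r.
    have -> : r = (r%:P).[H1] by rewrite hornerC.
    rewrite rE !hornerE /= dvdp_add //; apply: dvdp_mull.
      by have := congW RN H1P; rewrite /cong subr0.
    by have := P'1; rewrite /cong subr0.
  by move/(dvdp_leq r0); rewrite size_exp_XsubC ltnn.
have G0 : G != 0 by apply/negP => /eqP h; have := nG R; rewrite h dvdp0 => /(_ isT); lia.
have [L [g]] := multiplicity_XsubC G x0; rewrite G0 /= => gx EG.
have LR : (L <= R.-1)%N by apply: nG; rewrite EG dvdp_mull.
have kL : (k.+1 <= L)%N.
  rewrite leqNgt; apply/negP => Lk; move: H21; rewrite /cong -/G EG.
  move=> /(dvdp_trans (dvdp_exp2l T Lk)).
  by rewrite exprS dvdp_mul2r ?expf_neq0 ?polyXsubC_eq0 // dvdp_XsubCl (negbTE gx).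
have scale_neq0 G' H' : H'.[x0] = y0 -> eval2 G'^`() x0 y0 != 0 ->
    (((lift_scale G').[H']) ^+ E).[x0] != 0.
  by move=> h1 h2; rewrite horner_exp expf_neq0 // (horner_cong1 _ h1) /lift_scale /eval2 !horner_exp expf_neq0.
have van G' H' : H'.[x0] = y0 -> eval2 G'^`() x0 y0 != 0 -> cong x0 N G'.[H'] 0 ->
    divides G' (pullback E G' Q) -> cong x0 R (mmap polyC (jet_of H') Q) 0.
  move=> h1 h2 h3 [S ES]; apply: (cong_mulI (scale_neq0 _ _ h1 h2)).
  have h4 := pullback_cong sQ h3.
  rewrite Nk in h4; apply: (cong_trans (cong_sym (congW (leqnSn R) h4))); rewrite ES hornerM -(mulr0 S.[H']).
  by apply: congM; [exact: congxx|exact: congW h3].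
have v1 := van _ _ H1y dP H1P dvP; have v2 := van _ _ H2y dP' H2P dvP'.
case: j j0 hj sQj => -[|j] jk //= _ hj sQj; set jj := Ordinal jk in hj sQj *.
have jk' : (j <= k)%N by [].
have jL : (j < L)%N by exact: leq_ltn_trans jk' kL.
have LjR : ((L - j).+1 <= R)%N by clear -LR R0; lia.
have Lj2 : ((L - j).+1 <= (L - j) * 2)%N by clear -jL; lia.
(* The increment is cut off above y^(j): [Q] does not involve the higher derivatives, whose
   differences may vanish to a lower order. Here [L] is l + 1. *)
pose w (i : 'I_k.+2) := if (i <= j.+1)%N then jet_of H2 i - jet_of H1 i else 0.
have w_dvd (i : 'I_k.+2) : (i < j.+1)%N -> T ^+ (L - j).+1 %| w i.
  rewrite /w /jet_of => ij; rewrite (ltnW ij); case: i ij => -[|i] /= hi ij; first by rewrite subrr dvdp0.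
  rewrite -derivnB -/G EG; have [|g' -> _] := @derivn_mul_XsubCn x0 g L i.
    by clear -ij jL; lia.
  by apply: dvdp_mull; apply: dvdp_exp2l; clear -ij jL; lia.
have [gj Egj gjx] := @derivn_mul_XsubCn x0 g L j (ltnW jL).
have wj : w jj = gj * T ^+ (L - j) by rewrite /w leqnn /jet_of /= -derivnB -/G EG.
have w_dvd' i : T ^+ (L - j) %| w i.
  case: (ltngtP i j.+1) => [ij|ij|ij].
  - by apply: dvdp_trans (w_dvd i ij); apply: dvdp_exp2l.
  - by rewrite /w leqNgt ij dvdp0.
  - by rewrite (_ : i = jj) ?wj ?dvdp_mull //; apply: val_inj.
have := mpoly_taylor (jet_of H1) Q w_dvd'.
rewrite (bigD1 jj) //= wj.
have -> : mmap polyC (fun i => jet_of H1 i + w i) Q = mmap polyC (jet_of H2) Q.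
  apply: mmap_indep => i; rewrite /w; case: leqP => [|ij]; first by rewrite subrKC; left.
  by right; apply: hj.
set a2 := mmap _ _ Q in v2 *; set a1 := mmap _ _ Q in v1 *.
set rest := \sum_(_ | _) _; set b := mmap _ _ _.
move=> htay.
have rest0 : T ^+ (L - j).+1 %| rest.
  apply: (big_ind (fun a => T ^+ (L - j).+1 %| a)) => [||i ij]; [exact: dvdp0|by move=> *; exact: dvdp_add|].
  apply: dvdp_mull; case: (ltngtP i j.+1) => [/w_dvd//|ij'|ij'].
    by rewrite /w leqNgt ij' dvdp0.
  by move: ij; rewrite (_ : i = jj) ?eqxx //; apply: val_inj.
have htay' : T ^+ (L - j).+1 %| a2 - a1 - (b * (gj * T ^+ (L - j)) + rest).
  by apply: dvdp_trans htay; rewrite -exprM; apply: dvdp_exp2l.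
have v12 : T ^+ (L - j).+1 %| a2 - a1.
  have := congB v2 v1; rewrite subr0 /cong subr0; apply: dvdp_trans; exact: dvdp_exp2l.
(* The Taylor error has order 2(L - j), at least L - j + 1, and the other terms have that order too.
   Hence [b * gj] vanishes at x0, while [gj] does not. *)
have : T ^+ (L - j).+1 %| b * gj * T ^+ (L - j).
  have -> : b * gj * T ^+ (L - j) =
    (a2 - a1) - (a2 - a1 - (b * (gj * T ^+ (L - j)) + rest)) - rest by ring.
  by apply: dvdp_sub => //; apply: dvdp_sub.
rewrite exprS dvdp_mul2r ?expf_neq0 ?polyXsubC_eq0 // dvdp_XsubCl rootM => /orP[|]; last first.
  by rewrite /root gjx mulrn_eq0 -[g.[x0] == 0]/(root g x0) (negbTE gx) orbF -leqn0 leqNgt ffact_gt0 ltnW.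
move=> /eqP bx.
have := pullback_cong (E := E) sQj H1P; rewrite Nk => /(congW (M := 1) (ltn0Sn R)) /cong1P; rewrite (horner_cong1 _ H1y) => ->.
by rewrite hornerM -/b bx mulr0.
Qed.

End Lifting.

(** * Counting contacts *)

Section Counting.
Variables (F : numClosedFieldType) (k D : nat).
Hypothesis k_gt0 : (0 < k)%N.
Implicit Types (P G : {poly {poly F}}) (Q : mpoly k.+2 F) (s : seq {poly {poly F}}).

Lemma underdetermined (I J : finType) (a : I -> J -> F) : (#|J| < #|I|)%N ->
  exists2 u : I -> F, exists i, u i != 0 & forall j, \sum_i u i * a i j = 0.
Proof.
move=> IJ; pose A := \matrix_(i < #|I|, j < #|J|) a (enum_val i) (enum_val j).
have kerA : kermx A != 0.
  rewrite kermx_eq0; apply/negP => /eqP rA.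
  by have := rank_leq_col A; rewrite rA leqNgt IJ.
pose w := nz_row (kermx A).
have w0 : w != 0 by rewrite nz_row_eq0.
have wA : w *m A = 0 by apply/sub_kermxP; apply: nz_row_sub.
exists (fun i => w 0 (enum_rank i)).
  case/rV0Pn: w0 => i wi; exists (enum_val i); by rewrite enum_valK.
move=> j; transitivity ((w *m A) 0 (enum_rank j)); last by rewrite wA mxE.
rewrite mxE (reindex (@enum_val I predT)) /=; last by apply: onW_bij; apply: enum_val_bij.
by apply: eq_bigr => i _; rewrite !mxE enum_valK enum_rankK.
Qed.

Definition vanishes_on E P Q := divides P (pullback E P Q).

(** At a fixed point the condition on [Q] becomes one linear form, [v] being independent of [Q]. The
    strict degree bound matters where [lift_scale] vanishes: every term then keeps a positive power
    of it, and both sides are 0. *)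
Lemma eval2_pullback E P x y : exists v : 'I_k.+2 -> F, forall Q, (msize Q <= E)%N ->
  eval2 (pullback E P Q) x y = eval2 (lift_scale k P) x y ^+ E * meval v Q.
Proof.
pose theta : {rmorphism {poly {poly F}} -> F} := horner_eval x \o horner_eval y%:P.
have [W0|W0] := eqVneq (eval2 (lift_scale k P) x y) 0.
  exists (fun=> 0) => Q sQ; rewrite -[LHS]/(theta _) /pullback rmorph_sum big_seq.
  rewrite big1 => [|m hm].
    have [E0|E0] := posnP E; last by rewrite W0 expr0n gtn_eqF // mul0r.
    by move: sQ; rewrite E0 leqn0 mmeasure_poly_eq0 => /eqP ->; rewrite meval0 mulr0.
  have mE : (mdeg m < E)%N by apply: leq_trans (msize_mdeg_lt hm) sQ.
  rewrite !rmorphM rmorphXn -[theta (lift_scale k P)]/(eval2 _ x y) W0.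
  by rewrite expr0n subn_eq0 leqNgt mE mul0r mulr0.
exists (fun i => eval2 (lift_coord P i) x y / eval2 (lift_scale k P) x y) => Q sQ.
set v := fun _ => _.
rewrite -[LHS]/(theta _) (@pullback_rel F k F theta eq _ _ _ E P Q v) ?leqW //; first last.
- by move=> i; rewrite /= /v mulrC divfK.
- by move=> ? ? ? ? -> ->.
- by move=> ? ? ? ? -> ->.
congr (_ * _); rewrite mevalE; apply: eq_bigr => m _.
by rewrite /= /horner_eval !hornerC.
Qed.

(** A box of exponents, so that the number of unknowns is exactly [d ^ k.+2]. *)
Definition box_mnm d (f : {ffun 'I_k.+2 -> 'I_d}) : multinom k.+2 :=
  Multinom (mktuple (fun i => f i : nat)).

Lemma box_mnm_inj d : injective (@box_mnm d).
Proof.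
move=> f g /mnmP fg; apply/ffunP => i; apply: val_inj; have := fg i.
by rewrite /box_mnm !mnmE.
Qed.

Section Degree.
Variable d : nat.
Let E := (k.+2 * d)%N.
Let M := ((1 + 2 * D * k) * E)%N.
Let B := (2 * (D * M) * D)%N.

Definition admissible s := forall P, P \in s ->
  [/\ irreducible_elt P, (1 < size P)%N, bidegree_le D P
    & forall P', P' \in s -> P' <> P -> ~ divides P P'].

(** [d ^ k.+2] coefficients against one linear condition for each test point of each curve. *)
Lemma vanishing_exists s : admissible s ->
    (size s * (2 * (D * M) + D.+1) < d ^ k.+2)%N ->
  exists Q, [/\ Q != 0, (msize Q <= E)%N & forall P, P \in s -> vanishes_on E P Q].
Proof.
move=> hs hd; pose N := (2 * (D * M) + D.+1)%N.
have /boolp.choice[f hf] : forall P, exists f : nat -> F * F, P \in s -> forall G, bidegree_le M G ->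
    (forall i, eval2 P (f i).1 (f i).2 = 0 -> (i < N)%N -> eval2 G (f i).1 (f i).2 = 0) -> divides P G.
  move=> P; have [Ps|nPs] := boolP (P \in s); last by exists (fun=> 0).
  by case: (hs P Ps) => h1 h2 h3 _; have [f hf] := test_points h1 h2 h3; exists f => _; apply: hf.
have /boolp.choice[v hv] : forall p : {poly {poly F}} * (F * F), exists v : 'I_k.+2 -> F, forall Q,
    (msize Q <= E)%N -> eval2 (pullback E p.1 Q) p.2.1 p.2.2 =
      eval2 (lift_scale k p.1) p.2.1 p.2.2 ^+ E * meval v Q.
  by move=> p; apply: eval2_pullback.
pose a (g : {ffun 'I_k.+2 -> 'I_d}) (j : 'I_(size s) * 'I_N) :=
  let P := nth 0 s j.1 in meval (v (P, f P j.2)) (mpolyX F (box_mnm g)).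
have [|u [g0 ug0] hu] := @underdetermined _ _ a.
  by rewrite card_prod !card_ord card_ffun !card_ord.
pose Q : mpoly k.+2 F := \sum_g u g *: mpolyX F (box_mnm g).
have sQ : (msize Q <= E)%N.
  apply: leq_trans (mmeasure_sum _ _ _ _) _; apply/bigmax_leqP => g _.
  apply: leq_trans (mmeasureZ_le _ _ _) _; rewrite msizeX mdegE.
  have d0 : (0 < d)%N by case: (d) hd => //; rewrite exp0n.
  apply: (@leq_trans (\sum_(i < k.+2) d.-1).+1).
    rewrite ltnS; apply: leq_sum => i _; by rewrite /box_mnm mnmE -ltnS prednK.
  rewrite sum_nat_const card_ord /E; nia.
exists Q; split => //.
  apply: contraNneq ug0 => Q0; have : mcoeff (box_mnm g0) Q = 0 by rewrite Q0 mcoeff0.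
  rewrite /Q raddf_sum (bigD1 g0) //= mcoeffZ mcoeffX eqxx mulr1 big1 ?addr0; first by move=> ->.
  move=> g gg0; rewrite mcoeffZ mcoeffX (inj_eq (@box_mnm_inj d)) (negbTE gg0) mulr0 //.
move=> P Ps; have [h1 h2 h3 _] := hs P Ps; apply: hf => //.
  by apply: bidegree_pullback => //; apply: leqW.
move=> i _ iN; rewrite (hv (P, f P i)) //=.
have hP : (index P s < size s)%N by rewrite index_mem.
have := hu (Ordinal hP, Ordinal iN); rewrite /a /= nth_index // => hu'.
rewrite /Q raddf_sum /=; under eq_bigr do rewrite mevalZ.
by rewrite hu' mulr0.
Qed.

Lemma msize_mderiv_lt Q i : Q != 0 -> (msize (mderiv i Q) < msize Q)%N.
Proof.
move=> Q0; have sQ : (0 < msize Q)%N by rewrite lt0n mmeasure_poly_eq0.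
rewrite -(prednK sQ) ltnS msizeE; apply/bigmax_leqP_seq => m hm _.
have : mnm_add m (mnm1 i) \in msupp Q.
  rewrite mcoeff_msupp; apply: contraTneq hm => h.
  by rewrite mcoeff_msupp mcoeff_deriv h mul0rn eqxx.
by move/msize_mdeg_lt; rewrite mdegD mdeg1 addn1; case: (msize Q) sQ.
Qed.

Lemma not_divides_exp P G n : irreducible_elt P -> (1 < size P)%N ->
  ~ divides P G -> ~ divides P (G ^+ n).
Proof.
move=> irrP szP nG; elim: n => [|n IH].
  by rewrite expr0 => /divides_size; rewrite oner_neq0 size_poly1 leqNgt szP => /(_ isT).
by rewrite exprS => /(irreducible_prime irrP szP)[].
Qed.

Lemma not_divides_deriv P : (1 < size P)%N -> ~ divides P P^`().
Proof.
move=> szP /divides_size h; have P0 : P != 0 by rewrite -size_poly_gt0 ltnW.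
have := lt_size_deriv P0; rewrite ltnNge h //; apply/negP => /eqP dP.
have nz : ((size P).-1 != 0)%N by rewrite -lt0n -ltnS prednK // ltnW.
move: P0; rewrite -lead_coef_eq0 lead_coefE => /negP; apply; apply/eqP/polyP => i.
have := congr1 (fun G : {poly {poly F}} => G`_(size P).-2`_i) dP.
rewrite coef_deriv !coef0 coefMn prednK ?lt0n // => /eqP.
by rewrite mulrn_eq0 (negbTE nz) => /eqP.
Qed.

Lemma some_curve_few_contacts s P0 : P0 \in s -> admissible s ->
    (size s * (2 * (D * M) + D.+1) < d ^ k.+2)%N ->
  exists2 P, P \in s & exists2 L : seq (F * F), (size L <= B)%N
    & forall P' x y, P' \in s -> P' <> P -> contact k P P' x y -> (x, y) \in L.
Proof.
move=> P0s hs /(vanishing_exists hs)[Q [Q0 sQ hQ]].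
have [m] := ubnP (msize Q); elim: m Q Q0 sQ hQ => // m IH Q Q0 sQ hQ; rewrite ltnS => Qm.
pose top (i : 'I_k.+2) := (0 < i)%N && (mderiv i Q != 0).
have [i0 top0|ntop] := pickP top.
  case: (arg_maxnP (fun i : 'I_k.+2 => i : nat) top0) => j /andP[j0 jQ] jmax.
  have hj (i : 'I_k.+2) : (j < i)%N -> mderiv i Q = 0.
    move=> ji; apply/eqP; apply: contraT => iQ.
    have := jmax i; rewrite /top iQ andbT (leq_ltn_trans _ ji) // => /(_ isT).
    by rewrite /= leqNgt ji.
  have sj := msize_mderiv_lt j Q0.
  have sjE : (msize (mderiv j Q) <= E)%N by apply: leq_trans sQ; apply: ltnW.
  (* Minimality takes the form of a descent: a derivative that vanishes on all lifts replaces [Q],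
     with [E] unchanged. *)
  have [vj|nvj] := pselect (forall P, P \in s -> vanishes_on E P (mderiv j Q)).
    exact: IH jQ sjE vj (leq_trans sj Qm).
  have [P Ps nP] : exists2 P, P \in s & ~ vanishes_on E P (mderiv j Q).
    by apply: contrapT => h; apply: nvj => P Ps; apply: contrapT => h'; apply: h; exists P.
  exists P => //; have [irrP szP bP ndiv] := hs P Ps.
  have [L sL hL] := weak_Bezout irrP szP nP bP (bidegree_pullback bP (leqW sjE)).
  exists L => // P' x y P's P'P hc; apply: hL; first by case: hc.
  apply: contact_top_derivative hc _ _ _ j0 hj _ => //; [exact: ndiv|exact: leqW|exact: hQ|exact: hQ|exact: leqW].
(* Here [Q] would involve x alone. Then [P0] would divide a power of P_y times a nonzero q(x), which
   its primality forbids. *)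
have [irrP szP bP _] := hs P0 P0s; exfalso.
have supp0 m' (i : 'I_k.+2) : m' \in msupp Q -> (0 < i)%N -> m' i = 0%N.
  by move=> hm i0; apply: mderiv0_supp hm; apply/eqP; have := ntop i; rewrite /top i0 => /negbFE.
pose q : {poly F} := \sum_(m' <- msupp Q) mcoeff m' Q *: 'X^(m' ord0).
have q0 : q != 0.
  have [m0 hm0] : exists m0, m0 \in msupp Q.
    by case E0: (msupp Q) => [|m0 l]; [move: Q0; rewrite -msupp_eq0 E0|exists m0; rewrite mem_head].
  apply: contraTneq hm0 => qz; apply/negP => hm0; have := hm0; rewrite mcoeff_msupp => /eqP[].
  have := congr1 (fun p : {poly F} => p`_(m0 ord0)) qz.
  rewrite coef0 coef_sum (bigD1_seq m0) ?msupp_uniq //= coefZ coefXn eqxx mulr1.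
  rewrite big_seq_cond big1 ?addr0 // => m' /andP[hm' m'm0].
  rewrite coefZ coefXn; case: eqP => [e|]; last by rewrite mulr0.
  case/eqP: m'm0; apply/mnmP => i; have [i0|i0] := posnP i; last by rewrite !supp0.
  by rewrite (_ : i = ord0) //; apply: val_inj.
have : divides P0 (lift_scale k P0 ^+ E * q%:P).
  have := hQ _ P0s; rewrite /vanishes_on; congr (divides _ _).
  rewrite /pullback /q rmorph_sum big_distrr /=; apply: eq_big_seq => m' hm.
  have mE : (m' ord0 = mdeg m').
    by rewrite mdegE big_ord_recl big1 ?addn0 // => i _; rewrite supp0.
  rewrite big_ord_recl big1 ?mulr1 => [|i _]; last by rewrite supp0 ?expr0.
  have mdE : (mdeg m' <= E)%N by apply: leq_trans sQ; apply: ltnW; apply: msize_mdeg_lt.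
  rewrite /= exprMn mE -{2}(subnK mdE) exprD -mul_polyC polyCM rmorphXn /=.
  by ring.
case/(irreducible_prime irrP szP) => [|/divides_size].
  by do 2 (apply: not_divides_exp => //); apply: not_divides_deriv.
by rewrite polyC_eq0 size_polyC q0 leqNgt szP => /(_ isT).
Qed.

Lemma contacts_cover s : admissible s ->
    (size s * (2 * (D * M) + D.+1) < d ^ k.+2)%N ->
  exists2 L : seq ({poly {poly F}} * (F * F)), (size L <= size s * (2 * B))%N
    & forall P P' x y, P \in s -> P' \in s -> P' <> P -> contact k P P' x y -> (P, (x, y)) \in L.
Proof.
have [n] := ubnP (size s); elim: n s => // n IH s; rewrite ltnS => sn hs hd.
case E0 : s => [|P0 s0]; first by exists [::].
have P0s : P0 \in s by rewrite E0 mem_head.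
rewrite -E0; have [P Ps [Lp sLp hLp]] := some_curve_few_contacts P0s hs hd.
pose s' := [seq P' <- s | P' != P].
have ss' : (size s' < size s)%N.
  by rewrite size_filter -(count_predC (pred1 P) s) -[X in (X < _)%N]add0n ltn_add2r -has_count has_pred1.
have s's P' : P' \in s' -> P' \in s by rewrite mem_filter => /andP[].
have [||L sL hL] := IH s' (leq_trans ss' sn).
- by move=> P1 /s's /hs[h1 h2 h3 h4]; split=> // P2 /s's; apply: h4.
- by apply: leq_ltn_trans hd; rewrite leq_mul2r ltnW ?orbT.
(* The curve written off along with [P] is the first of [s'] touching it at p. Any other curve
   touching [P] there touches this partner by transitivity, so the induction hypothesis records
   it. *)
pose partner (p : F * F) := nth P s' (find (fun P' => `[< contact k P P' p.1 p.2 >]) s').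
exists (L ++ [seq (P, p) | p <- Lp] ++ [seq (partner p, p) | p <- Lp]).
  rewrite !size_cat !size_map; apply: leq_trans (leq_mul ss' (leqnn _)); rewrite mulSn addnC.
  apply: leq_add => //; lia.
move=> P1 P2 x y P1s P2s P21 c12; rewrite !mem_cat.
have [P1P|P1P] := eqVneq P1 P.
  by rewrite P1P in c12 P21 *; rewrite (map_f (pair P)) ?orbT //; apply: (hLp P2).
have P1s' : P1 \in s' by rewrite mem_filter P1P.
have [P2P|P2P] := eqVneq P2 P; last first.
  by rewrite (hL P1 P2) // mem_filter P2P.
rewrite P2P in c12; have c1 := contact_sym c12.
have pL : (x, y) \in Lp by apply: (hLp P1) => //; apply/eqP.
have hp : has (fun P' => `[< contact k P P' x y >]) s' by apply/hasP; exists P1 => //; apply/asboolP.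
have c2 : contact k P (partner (x, y)) x y by apply/asboolP; have := nth_find P hp.
have [<-|ne] := eqVneq (partner (x, y)) P1.
  by rewrite (map_f (fun p => (partner p, p))) ?orbT.
rewrite (hL P1 (partner (x, y))) //; [by rewrite mem_nth // -has_find|exact/eqP|].
exact: contact_trans c12 c2.
Qed.

Lemma vertical_points P : irreducible_elt P -> (1 < size P)%N -> bidegree_le D P ->
  exists2 L : seq (F * F), (size L <= 2 * (D * D) * D)%N
    & forall x y, eval2 P x y = 0 -> eval2 P^`() x y = 0 -> (x, y) \in L.
Proof.
move=> irrP szP bP.
exact: weak_Bezout irrP szP (not_divides_deriv szP) bP (bidegree_le_deriv bP).
Qed.

End Degree.
End Counting.

(** * From distances to contact *)

Section AbsoluteValue.
Variables (F : numClosedFieldType) (R : realFieldType) (abs : F -> R).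
Hypothesis abs0 : abs 0 = 0.
Hypothesis abs_eq0 : forall x, abs x = 0 -> x = 0.
Hypothesis absM : forall x y, abs (x * y) = abs x * abs y.
Hypothesis absD : forall x y, abs (x + y) <= abs x + abs y.
Hypothesis absN : forall x, abs (- x) = abs x.
Implicit Types (P : {poly {poly F}}) (p : {poly F}) (x y : F).

Lemma abs_ge0 x : 0 <= abs x.
Proof.
by have := absD x (- x); rewrite subrr absN abs0; lra.
Qed.

Lemma absB x y : abs (x - y) <= abs x + abs y.
Proof. by rewrite -(absN y); exact: absD. Qed.

Lemma absBC x y : abs (x - y) = abs (y - x).
Proof. by rewrite -absN opprB. Qed.

Lemma absX x n : abs (x ^+ n) = abs x ^+ n.
Proof.
have abs1 : abs 1 = 1.
  have : abs 1 != 0 by apply/negP => /eqP/abs_eq0/eqP; rewrite oner_eq0.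
  by move=> h; apply: (mulfI h); rewrite -absM !mulr1.
by elim: n => [|n IH]; rewrite ?expr0 // !exprS absM IH.
Qed.

Lemma poly_bounded p x0 : exists2 K, 0 <= K & forall x, abs (x - x0) <= 1 -> abs p.[x] <= K.
Proof.
elim/poly_ind: p => [|p c [K K0 IH]]; first by exists 0 => // x _; rewrite horner0 abs0.
have cx := abs_ge0 x0; have cc := abs_ge0 c.
exists (K * (1 + abs x0) + abs c) => [|x hx]; first by nra.
rewrite !hornerE; apply: le_trans (absD _ _) _; rewrite lerD2r absM.
have := IH x hx; have hx' : abs x <= 1 + abs x0.
  by rewrite -(subrK x0 x); apply: le_trans (absD _ _) _; rewrite lerD2r.
by have := abs_ge0 x; have := abs_ge0 p.[x]; nra.
Qed.

Lemma poly_lipschitz_at p x0 : exists2 K, 0 <= K & forall x, abs (x - x0) <= 1 ->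
  abs (p.[x] - p.[x0]) <= K * abs (x - x0).
Proof.
have /factor_theorem[q E] : root (p - p.[x0]%:P) x0 by rewrite /root !hornerE subrr.
have [K K0 hK] := poly_bounded q x0; exists K => // x hx.
have -> : p.[x] - p.[x0] = (p - p.[x0]%:P).[x] by rewrite !hornerE.
by rewrite E !hornerE absM ler_wpM2r ?abs_ge0 // hK.
Qed.

(** With order of vanishing m < N, |p(x)| would be about |g(x0)| |x - x0|^m, too large near x0.
    Sample points arbitrarily near x0 suffice, which is all that [close] provides. *)
Lemma order_of_small p x0 N C :
    (forall eps, 0 < eps -> exists x,
       [/\ 0 < abs (x - x0), abs (x - x0) < eps & abs p.[x] <= C * abs (x - x0) ^+ N]) ->
  ('X - x0%:P) ^+ N %| p.
Proof.
move=> h; have [->|p0] := eqVneq p 0; first exact: dvdp0.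
have [m [g]] := multiplicity_XsubC p x0; rewrite p0 /= => gx pE.
have [Nm|mN] := leqP N m; first by rewrite pE; apply: dvdp_mull; apply: dvdp_exp2l.
exfalso; have [K K0 hK] := poly_lipschitz_at g x0.
have g0 : 0 < abs g.[x0].
  by rewrite lt_neqAle abs_ge0 andbT eq_sym; apply: contra gx => /eqP/abs_eq0 gz; apply/eqP.
pose eps := Num.min 1 (abs g.[x0] / (`|C| + K + 1)).
have CK : 0 < `|C| + K + 1 by have := normr_ge0 C; lra.
have [|x [x0' xe px]] := h eps; first by rewrite lt_min ltr01 divr_gt0.
set a := abs (x - x0) in x0' xe px; move: xe; rewrite lt_min => /andP[a1].
rewrite ltr_pdivlMr // => xe.
have gxle : abs g.[x] <= `|C| * a.
  have am : 0 < a ^+ m by exact: exprn_gt0.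
  rewrite -(ler_pM2r am); apply: le_trans (_ : abs p.[x] <= _).
    by rewrite pE !(hornerE, horner_exp) absM absX.
  apply: le_trans px _; apply: le_trans (_ : `|C| * a ^+ N <= _).
    by rewrite ler_wpM2r ?exprn_ge0 ?ler_norm // ltW.
  rewrite -mulrA ler_wpM2l // -exprS; apply: ler_wiXn2l => //; exact: ltW.
have := hK x (ltW a1); rewrite -/a absBC => hg.
have := absD (g.[x0] - g.[x]) g.[x]; rewrite subrK; nra.
Qed.

(** A two-point estimate, because values at points of two different curves are compared. Its
    stability under sums and products extends it to all polynomials by induction. *)
Definition strict_diff (f : F -> F -> F) x0 y0 a b : Prop :=
  exists2 L, 0 <= L & forall x y x' y',
    abs (x - x0) + abs (y - y0) <= 1 -> abs (x' - x0) + abs (y' - y0) <= 1 ->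
    abs (f x y - f x' y' - (a * (x - x') + b * (y - y'))) <=
      L * ((abs (x - x0) + abs (y - y0)) + (abs (x' - x0) + abs (y' - y0)))
        * (abs (x - x') + abs (y - y')).

Lemma strict_diffD f g x0 y0 a b a' b' :
  strict_diff f x0 y0 a b -> strict_diff g x0 y0 a' b' ->
  strict_diff (fun x y => f x y + g x y) x0 y0 (a + a') (b + b').
Proof.
move=> [L L0 hf] [M M0 hg]; exists (L + M) => [|x y x' y' h h']; first exact: addr_ge0.
have := hf x y x' y' h h'; have := hg x y x' y' h h'.
set e := f x y - _ - _; set e' := g x y - _ - _ => h1 h2.
have -> : f x y + g x y - (f x' y' + g x' y') - ((a + a') * (x - x') + (b + b') * (y - y')) = e + e'.
  by rewrite /e /e'; ring.
by apply: le_trans (absD _ _) _; rewrite !mulrDl lerD.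
Qed.

Lemma strict_diff_lip f x0 y0 a b : strict_diff f x0 y0 a b ->
  exists2 K, 0 <= K & forall x y x' y',
    abs (x - x0) + abs (y - y0) <= 1 -> abs (x' - x0) + abs (y' - y0) <= 1 ->
    abs (f x y - f x' y') <= K * (abs (x - x') + abs (y - y')).
Proof.
move=> [L L0 hf]; have ha := abs_ge0 a; have hb := abs_ge0 b.
exists (abs a + abs b + 2 * L) => [|x y x' y' h h']; first by nra.
have := hf x y x' y' h h'; set e := abs (_ - (_ + _)) => he.
have : abs (f x y - f x' y') <= e + (abs a * abs (x - x') + abs b * abs (y - y')).
  rewrite -[X in abs X](subrK (a * (x - x') + b * (y - y'))).
  apply: le_trans (absD _ _) _; rewrite lerD2l.
  by apply: le_trans (absD _ _) _; rewrite !absM.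
have d1 := abs_ge0 (x - x'); have d2 := abs_ge0 (y - y').
have m1 := abs_ge0 (x - x0); have m2 := abs_ge0 (y - y0).
have m1' := abs_ge0 (x' - x0); have m2' := abs_ge0 (y' - y0).
move: he; move: (abs (x - x')) (abs (y - y')) d1 d2 => d1 d2 d10 d20.
set m := (abs (x - x0) + _) in h *; set m' := (abs (x' - x0) + _) in h' *.
move=> he; have : L * (m + m') * (d1 + d2) <= 2 * L * (d1 + d2).
  by apply: ler_wpM2r; [exact: addr_ge0|nra].
nra.
Qed.

Lemma strict_diffM f g x0 y0 a b a' b' :
  strict_diff f x0 y0 a b -> strict_diff g x0 y0 a' b' ->
  strict_diff (fun x y => f x y * g x y) x0 y0
    (a * g x0 y0 + f x0 y0 * a') (b * g x0 y0 + f x0 y0 * b').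
Proof.
move=> sf sg; have [L L0 hf] := sf; have [M M0 hg] := sg.
have [K K0 kf] := strict_diff_lip sf; have [K' K'0 kg] := strict_diff_lip sg.
have h0 : abs (x0 - x0) + abs (y0 - y0) <= 1 by rewrite !subrr abs0 addr0.
have [fa ga] := (abs_ge0 (f x0 y0), abs_ge0 (g x0 y0)).
have [aa bb] := (abs_ge0 a, abs_ge0 b); have [aa' bb'] := (abs_ge0 a', abs_ge0 b').
exists (L * (abs (g x0 y0) + K') + (abs a + abs b) * K' + (abs (f x0 y0) + K) * M + K * (abs a' + abs b')).
  by repeat (apply: addr_ge0); apply: mulr_ge0 => //; apply: addr_ge0.
move=> x y x' y' h h'.
have := hf x y x' y' h h'; have := hg x y x' y' h h'.
have := kf x' y' x0 y0 h' h0; have := kg x y x0 y0 h h0.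
set e := f x y - _ - _; set e' := g x y - _ - _.
(* Each of the four terms is either a bounded factor times a given error, or a linear form in the
   increments times a deviation from the value at the centre. *)
have -> : f x y * g x y - f x' y' * g x' y' -
    ((a * g x0 y0 + f x0 y0 * a') * (x - x') + (b * g x0 y0 + f x0 y0 * b') * (y - y')) =
  e * g x y + (a * (x - x') + b * (y - y')) * (g x y - g x0 y0)
  + f x' y' * e' + (f x' y' - f x0 y0) * (a' * (x - x') + b' * (y - y')).
  by rewrite /e /e'; ring.
set dx := x - x'; set dy := y - y'.
set dg := g x y - g x0 y0; set df := f x' y' - f x0 y0.
have gb : abs (g x y) <= abs (g x0 y0) + abs dg.
  by rewrite -[X in abs X](subrKC (g x0 y0)); apply: absD.
have fb : abs (f x' y') <= abs (f x0 y0) + abs df.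
  by rewrite -[X in abs X](subrKC (f x0 y0)); apply: absD.
have lb c c' : abs (c * dx + c' * dy) <= (abs c + abs c') * (abs dx + abs dy).
  apply: le_trans (absD _ _) _; rewrite !absM.
  have := abs_ge0 c; have := abs_ge0 c'; have := abs_ge0 dx; have := abs_ge0 dy; nra.
have l1 := lb a b; have l2 := lb a' b'.
have m1 : 0 <= abs (x - x0) + abs (y - y0) by rewrite addr_ge0 ?abs_ge0.
have m2 : 0 <= abs (x' - x0) + abs (y' - y0) by rewrite addr_ge0 ?abs_ge0.
have d0 : 0 <= abs dx + abs dy by rewrite addr_ge0 ?abs_ge0.
set m := abs (x - x0) + _ in h m1 *; set m' := abs (x' - x0) + _ in h' m2 *.
set d := abs dx + abs dy in l1 l2 d0 *.
move=> hdg hdf he' he.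
have hdg1 : abs dg <= K' by nra.
have hdf1 : abs df <= K by nra.
have D0 : 0 <= (m + m') * d by nra.
apply: le_trans (_ : abs e * abs (g x y) + abs (a * dx + b * dy) * abs dg
   + abs (f x' y') * abs e' + abs df * abs (a' * dx + b' * dy) <= _).
  by rewrite -!absM; do 3 (apply: le_trans (absD _ _) _; rewrite lerD2r).
have -> : (L * (abs (g x0 y0) + K') + (abs a + abs b) * K' + (abs (f x0 y0) + K) * M +
    K * (abs a' + abs b')) * (m + m') * d =
  L * (m + m') * d * (abs (g x0 y0) + K') + (abs a + abs b) * d * (K' * (m + m'))
  + (abs (f x0 y0) + K) * (M * (m + m') * d) + K * (m + m') * ((abs a' + abs b') * d) by ring.
have mm' : m <= m + m' by lra.
have m'm : m' <= m + m' by lra.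
apply: lerD; [apply: lerD; [apply: lerD|]|]; apply: ler_pM; rewrite ?abs_ge0 //.
- lra.
- by apply: le_trans hdg _; apply: ler_wpM2l.
- lra.
- by apply: le_trans hdf _; apply: ler_wpM2l.
Qed.

Lemma strict_diff_eval2 P x0 y0 :
  strict_diff (eval2 P) x0 y0 (eval2 (derivx P) x0 y0) (eval2 P^`() x0 y0).
Proof.
have sC (c : F) : strict_diff (fun _ _ => c) x0 y0 0 0.
  by exists 0 => // x y x' y' _ _; rewrite !mul0r subrr addr0 subr0 abs0.
have sx : strict_diff (fun x _ => x) x0 y0 1 0.
  by exists 0 => // x y x' y' _ _; rewrite !mul0r mul1r addr0 subrr abs0.
have sy : strict_diff (fun _ y => y) x0 y0 0 1.
  by exists 0 => // x y x' y' _ _; rewrite !mul0r mul1r add0r subrr abs0.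
have sP (p : {poly F}) : strict_diff (fun x _ => p.[x]) x0 y0 p^`().[x0] 0.
  elim/poly_ind: p => [|p c IH].
    have -> : (fun x _ : F => (0 : {poly F}).[x]) = (fun _ _ => 0) by apply/funext => x; rewrite horner0.
    by rewrite deriv0 horner0.
  have -> : (fun x _ : F => (p * 'X + c%:P).[x]) = (fun x y => p.[x] * x + c).
    by apply/funext => x; rewrite !hornerE.
  have := strict_diffD (strict_diffM IH sx) (sC c).
  by rewrite derivMXaddC !hornerE [X in strict_diff _ _ _ X]addrC.
elim/poly_ind: P => [|P c IH].
  have -> : eval2 (0 : {poly {poly F}}) = (fun _ _ => 0).
    by apply/funext => x; apply/funext => y; rewrite /eval2 !horner0.
  by rewrite derivx0 deriv0 /eval2 !horner0.
have -> : eval2 (P * 'X + c%:P) = (fun x y => eval2 P x y * y + c.[x]).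
  by apply/funext => x; apply/funext => y; rewrite /eval2 !hornerE.
have -> : eval2 (derivx (P * 'X + c%:P)) x0 y0 =
   (eval2 (derivx P) x0 y0 * y0 + eval2 P x0 y0 * 0) + c^`().[x0].
  by rewrite derivxD derivxMX derivxC /eval2 !hornerE.
have -> : eval2 (P * 'X + c%:P)^`() x0 y0 =
   (eval2 P^`() x0 y0 * y0 + eval2 P x0 y0 * 1) + 0.
  by rewrite derivMXaddC /eval2 !hornerE addrC.
exact: strict_diffD (strict_diffM IH sy) (sP c).
Qed.

(** All that is kept of tangency. The two points have separate abscissae, since points with equal
    abscissa in the rotated frame need not share one here. *)
Definition close k P P' x0 y0 : Prop := exists2 C, 0 <= C & forall eps, 0 < eps ->
  exists x y x' y', let m := abs (x - x0) + abs (y - y0) in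
    [/\ eval2 P x y = 0, eval2 P' x' y' = 0, 0 < m, m < eps
      & abs (x - x') + abs (y - y') <= C * m ^+ k.+1].

(** For k >= 1 both differentials are O(m^2) on the increment (x - x0, y - y0), of size m. Were they
    independent, Cramer's rule would give m = O(m^2), false for small m. *)
Lemma close_gradients k P P' x0 y0 : (0 < k)%N ->
    eval2 P x0 y0 = 0 -> eval2 P' x0 y0 = 0 -> close k P P' x0 y0 ->
  eval2 (derivx P) x0 y0 * eval2 P'^`() x0 y0 = eval2 P^`() x0 y0 * eval2 (derivx P') x0 y0.
Proof.
move=> k0 P0 P'0 [C C0 hC].
have sP := strict_diff_eval2 P x0 y0; have sP' := strict_diff_eval2 P' x0 y0.
move: sP sP'; set a := eval2 (derivx P) x0 y0; set b := eval2 P^`() x0 y0.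
set a' := eval2 (derivx P') x0 y0; set b' := eval2 P'^`() x0 y0 => sP sP'.
have [K K0 hK] := strict_diff_lip sP'; case: sP sP' => L L0 hL [L' L'0 hL'].
have h0 : abs (x0 - x0) + abs (y0 - y0) <= 1 by rewrite !subrr abs0 addr0.
apply/eqP; rewrite -subr_eq0; set det := _ - _; apply/eqP/abs_eq0/eqP.
rewrite -[_ == _]negbK; apply/negP => det0.
have dpos : 0 < abs det by rewrite lt_neqAle eq_sym det0 abs_ge0.
pose N := (abs a + abs b + abs a' + abs b') * (L + (L' + K * C)).
have N0 : 0 <= N.
  by rewrite /N mulr_ge0 // ?addr_ge0 ?abs_ge0 // mulr_ge0.
have C1 : 0 < 1 + C by lra.
have N1 : 0 < N + 1 by lra.
have [|x [y [x' [y' [Px P'x]]]]] := hC (Num.min (1 + C)^-1 (abs det / (N + 1))).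
  by rewrite lt_min invr_gt0 C1 divr_gt0.
set m := abs (x - x0) + abs (y - y0) => m0; rewrite lt_min ltr_pdivlMr // => /andP[mC md] hd.
have mC' : m * (1 + C) < 1 by rewrite -ltr_pdivlMr // div1r.
have m1 : m <= 1 by nra.
have dm2 : abs (x - x') + abs (y - y') <= C * m ^+ 2.
  apply: le_trans hd _; rewrite ler_wpM2l //; apply: ler_wiXn2l => //; exact: ltW.
have m'1 : abs (x' - x0) + abs (y' - y0) <= 1.
  have h1 := absD (x' - x) (x - x0); have h2 := absD (y' - y) (y - y0).
  rewrite !subrKA absBC in h1; rewrite !subrKA [abs (y' - y)]absBC in h2.
  have : m ^+ 2 <= m by rewrite expr2; nra.
  rewrite -/m in h1 h2; move: h1 h2 dm2 mC'; rewrite /m; nra.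
have e1 := hL x y x0 y0 m1 h0; rewrite Px P0 !subrr abs0 !addr0 sub0r absN -/m in e1.
have e2 := hL' x y x0 y0 m1 h0; rewrite P'0 !subrr abs0 !addr0 subr0 -/m in e2.
have e3 := hK x y x' y' m1 m'1; rewrite P'x subr0 in e3.
set s := x - x0 in e1 e2 *; set w := y - y0 in e1 e2 *.
have e4 : abs (a' * s + b' * w) <= (L' + K * C) * m ^+ 2.
  rewrite -(subKr (eval2 P' x y) (a' * s + b' * w)).
  apply: le_trans (absB _ _) _.
  have : K * (abs (x - x') + abs (y - y')) <= K * (C * m ^+ 2) by rewrite ler_wpM2l.
  move: e2 e3; rewrite mulrDl expr2 !mulrA; lra.
have e5 : abs (a * s + b * w) <= L * m ^+ 2 by rewrite expr2 mulrA.
set A := a * s + b * w in e5; set A' := a' * s + b' * w in e4.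
have hs : abs det * abs s <= abs b' * (L * m ^+ 2) + abs b * ((L' + K * C) * m ^+ 2).
  rewrite -absM (_ : det * s = b' * A - b * A'); last by rewrite /det /A /A'; ring.
  by apply: le_trans (absB _ _) _; rewrite !absM lerD // ler_wpM2l ?abs_ge0.
have hw : abs det * abs w <= abs a * ((L' + K * C) * m ^+ 2) + abs a' * (L * m ^+ 2).
  rewrite -absM (_ : det * w = a * A' - a' * A); last by rewrite /det /A /A'; ring.
  by apply: le_trans (absB _ _) _; rewrite !absM lerD // ler_wpM2l ?abs_ge0.
have M0 : 0 <= L' + K * C by rewrite addr_ge0 // mulr_ge0.
have [[aa ab] [aa' ab']] := ((abs_ge0 a, abs_ge0 b), (abs_ge0 a', abs_ge0 b')).
have : abs det * m <= N * m ^+ 2.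
  have -> : abs det * m = abs det * abs s + abs det * abs w by rewrite -mulrDr.
  apply: le_trans (lerD hs hw) _; rewrite /N.
  set M := L' + K * C in M0 *; have mm : 0 <= m ^+ 2 by exact: sqr_ge0.
  rewrite -subr_ge0.
  have -> : (abs a + abs b + abs a' + abs b') * (L + M) * m ^+ 2 -
    (abs b' * (L * m ^+ 2) + abs b * (M * m ^+ 2) + (abs a * (M * m ^+ 2) + abs a' * (L * m ^+ 2))) =
    (abs a * L + abs b * L + abs a' * M + abs b' * M) * m ^+ 2 by ring.
  by rewrite mulr_ge0 // !addr_ge0 // mulr_ge0.
rewrite expr2 mulrA ler_pM2r // => hN.
by have := md; rewrite mulrDr mulr1; nra.
Qed.

(** Let [H] be the branch of [P] to order k + 1. As P_y is nonzero, |y - H(x)| = O(|x - x0|^(k+1));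
    so the point of the second curve is that near to (x, H(x)), and the Lipschitz bound makes P'(x,
    H(x)) equally small. *)
Lemma close_contact k P P' x0 y0 :
    eval2 P x0 y0 = 0 -> eval2 P' x0 y0 = 0 ->
    eval2 P^`() x0 y0 != 0 -> eval2 P'^`() x0 y0 != 0 ->
  close k P P' x0 y0 -> contact k P P' x0 y0.
Proof.
move=> P0 P'0 dP dP' [C C0 hC]; split=> //.
have [H Hy HP] := Hensel_exists k.+1 P0 dP; exists H => //; split => //.
move: HP; rewrite /cong !subr0 => /dvdpP[q qE].
have [K1 K10 hq] := poly_bounded q x0; have [K2 K20 hH] := poly_lipschitz_at H x0.
have sP := strict_diff_eval2 P x0 y0; have sP' := strict_diff_eval2 P' x0 y0.
move: sP sP'; set a := eval2 (derivx P) x0 y0; set b := eval2 P^`() x0 y0 in dP *.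
move=> [L L0 hL] /strict_diff_lip[K K0 hK].
have b0 : 0 < abs b by rewrite lt_neqAle abs_ge0 andbT eq_sym; apply: contra dP => /eqP/abs_eq0/eqP.
(* [K3] controls y - H(x), its 2 paying for the absorption of the quadratic error; [K4] bounds m by
   |x - x0|; c m < 1 keeps all points in the unit ball of the estimates. *)
pose K3 := 2 * K1 / abs b; have K30 : 0 <= K3 by rewrite divr_ge0 ?mulr_ge0 // ltW.
pose K4 := 1 + K2 + K3; have K40 : 1 <= K4 by rewrite /K4; lra.
pose c := 1 + C + K2; have c1 : 1 <= c by rewrite /c; lra.
pose e0 := 1 + 2 * L * (1 + c) / abs b.
apply: (@order_of_small _ _ _ (K * (2 * K3 + 2 * (C * K4 ^+ k.+1)))) => eps eps0.
have [|x [y [x' [y' [Px P'x]]]]] := hC (Num.min eps (Num.min c^-1 (abs b / (1 + 2 * L * (1 + c))))).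
  by rewrite !lt_min eps0 invr_gt0 divr_gt0 ?andbT //=; nra.
set s := abs (x - x0); set w := abs (y - y0); set m := s + w => m0; rewrite !lt_min => /and3P[meps].
rewrite -[c^-1]div1r !ltr_pdivlMr; [|nra|nra] => mc mb hd.
have s0 : 0 <= s by exact: abs_ge0. 
have w0 : 0 <= w by exact: abs_ge0.
have sm : s <= m by rewrite /m lerDl.
have m1 : m <= 1 by nra.
have s1 : s <= 1 by lra.
have m''1 : s + abs (H.[x] - y0) <= c * m.
  by have := hH x s1; rewrite Hy -/s /c; nra.
have hPH : abs (eval2 P x H.[x]) <= K1 * s ^+ k.+1.
  rewrite -(horner_cong1 P (erefl H.[x])) qE hornerM absM horner_exp absX hornerXsubC -/s.
  by rewrite ler_wpM2r ?exprn_ge0 ?hq.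
have hyH : abs (y - H.[x]) <= K3 * s ^+ k.+1.
  have := hL x y x H.[x] m1 (le_trans m''1 (ltW _)); rewrite mulrC => /(_ mc).
  rewrite Px sub0r !subrr abs0 mulr0 !add0r -/s -/w -/m => h.
  set d := abs (y - H.[x]) in h *.
  have d0 : 0 <= d by exact: abs_ge0.
  have hb : abs b * d <= abs (eval2 P x H.[x]) + abs (- eval2 P x H.[x] - b * (y - H.[x])).
    rewrite -absM -(absN (eval2 P x H.[x])) -{1}(subKr (- eval2 P x H.[x]) (b * (y - H.[x]))).
    exact: absB.
  (* m was chosen so small that the quadratic error uses at most half of [abs b]. *)
  have : L * (m + (s + abs (H.[x] - y0))) * d <= abs b / 2 * d.
    by rewrite ler_wpM2r //; nra.
  have -> : K3 * s ^+ k.+1 = 2 * K1 * s ^+ k.+1 / abs b by rewrite /K3 [LHS]mulrAC.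
  by rewrite ler_pdivlMr //; move: hPH hb; set S := s ^+ _; set e := abs (eval2 _ _ _); lra.
have hw : w <= (K3 + K2) * s.
  have hs : s ^+ k.+1 <= s by rewrite exprS; apply: ler_piMr => //; exact: exprn_ile1.
  have -> : w = abs ((y - H.[x]) + (H.[x] - y0)) by rewrite subrKA.
  apply: le_trans (absD _ _) _; rewrite mulrDl; apply: lerD.
    by apply: le_trans hyH _; rewrite ler_wpM2l.
  by rewrite -Hy; apply: hH.
have mK : m <= K4 * s by rewrite /m /K4; lra.
have spos : 0 < s by rewrite lt_neqAle s0 andbT; apply: contraTneq mK => <-; rewrite mulr0 -ltNge.
exists x; split => //; first exact: le_lt_trans sm meps.
have mpow : m ^+ k.+1 <= K4 ^+ k.+1 * s ^+ k.+1.
  by rewrite -exprMn; apply: lerXn2r; rewrite ?nnegrE //; [exact: ltW|nra].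
have m'1 : abs (x' - x0) + abs (y' - y0) <= 1.
  have h1 := absD (x' - x) (x - x0); have h2 := absD (y' - y) (y - y0).
  rewrite !subrKA absBC in h1; rewrite !subrKA [abs (y' - y)]absBC in h2.
  have : C * m ^+ k.+1 <= C * m.
    by rewrite ler_wpM2l // exprS; apply: ler_piMr; [exact: ltW|apply: exprn_ile1 => //; exact: ltW].
  move: h1 h2 hd mc; rewrite -/s -/w /m /c; nra.
have := hK x H.[x] x' y' (le_trans m''1 (ltW _)) m'1; rewrite mulrC => /(_ mc).
rewrite P'x subr0 -(horner_cong1 P' (erefl H.[x])) => h; apply: le_trans h _.
rewrite -mulrA ler_wpM2l //.
have h3 : abs (H.[x] - y') <= abs (y - H.[x]) + abs (y - y').
  by rewrite -(subrKA y) [abs (y - H.[x])]absBC; apply: absD.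
have h4 : C * m ^+ k.+1 <= C * (K4 ^+ k.+1 * s ^+ k.+1) by rewrite ler_wpM2l.
have h5 : 0 <= K3 * s ^+ k.+1 by rewrite mulr_ge0 // exprn_ge0.
have [hx hy] := (abs_ge0 (x - x'), abs_ge0 (y - y')).
have h6 : 0 <= C * (K4 ^+ k.+1 * s ^+ k.+1).
  by apply: le_trans h4; rewrite mulr_ge0 // exprn_ge0 // ltW.
rewrite mulrDl -!(mulrA 2) -(mulrA C); lra.
Qed.

End AbsoluteValue.

(** * Curves in the complex plane *)

Section Conversion.
Variable F : numClosedFieldType.
Implicit Types (P Q : mpoly 2 F) (G : {poly {poly F}}).

Lemma ord2P (i : 'I_2) : i = 0 \/ i = 1.
Proof. by case: i => -[|[|n]] hn //; [left|right]; apply: val_inj. Qed.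

Definition coord_xy (T : Type) (x y : T) (j : 'I_2) : T := if j == 0 then x else y.

Definition to_bi : {rmorphism mpoly 2 F -> {poly {poly F}}} :=
  mmap (polyC \o polyC) (coord_xy 'X%:P 'X).

Definition of_poly : {rmorphism {poly F} -> mpoly 2 F} :=
  horner_morph (fun a => mulrC (mpolyX F (mnm1 (0 : 'I_2))) (mpolyC 2 a)).

Definition of_bi : {rmorphism {poly {poly F}} -> mpoly 2 F} :=
  horner_morph (fun a => mulrC (mpolyX F (mnm1 (1 : 'I_2))) (of_poly a)).

Lemma to_biC c : to_bi (mpolyC 2 c) = c%:P%:P.
Proof. exact: mmapC. Qed.

Lemma to_biX i : to_bi (mpolyX F (mnm1 i)) = coord_xy 'X%:P 'X i.
Proof. by rewrite /to_bi /= mmapX mmap1U. Qed.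

Lemma of_polyC c : of_poly c%:P = mpolyC 2 c.
Proof. exact: horner_morphC. Qed.

Lemma of_polyX : of_poly 'X = mpolyX F (mnm1 (0 : 'I_2)).
Proof. exact: horner_morphX. Qed.

Lemma of_biC c : of_bi c%:P = of_poly c.
Proof. exact: horner_morphC. Qed.

Lemma of_biX : of_bi 'X = mpolyX F (mnm1 (1 : 'I_2)).
Proof. exact: horner_morphX. Qed.

Lemma of_biK G : to_bi (of_bi G) = G.
Proof.
elim/poly_ind: G => [|G c IH]; first by rewrite !rmorph0.
rewrite !rmorphD !rmorphM /= IH of_biX to_biX of_biC /coord_xy /=; congr (_ + _).
elim/poly_ind: c => [|c a IHc]; first by rewrite !rmorph0.
by rewrite !rmorphD !rmorphM /= IHc of_polyC to_biC of_polyX to_biX.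
Qed.

Lemma to_biK P : of_bi (to_bi P) = P.
Proof.
elim/(@mpoly_ring_ind F 0): P => [c|i|P Q IH IH'|P Q IH IH'].
- by rewrite to_biC of_biC of_polyC.
- by rewrite to_biX; case: (ord2P i) => ->; rewrite /coord_xy /= ?of_biX // of_biC of_polyX.
- by rewrite !rmorphD /= IH IH'.
- by rewrite !rmorphM /= IH IH'.
Qed.

Lemma eval2_to_bi P x y : eval2 (to_bi P) x y = meval (coord_xy x y) P.
Proof.
elim/(@mpoly_ring_ind F 0): P => [c|i|P Q IH IH'|P Q IH IH'].
- by rewrite to_biC mevalC /eval2 !hornerC.
- rewrite to_biX mevalXU /eval2; case: (ord2P i) => ->.
    by rewrite /coord_xy /= hornerC hornerX.
  by rewrite /coord_xy /= hornerX hornerC.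
- by rewrite rmorphD eval2D IH IH' mevalD.
- by rewrite rmorphM eval2M IH IH' mevalM.
Qed.

Lemma deriv_to_bi P : (to_bi P)^`() = to_bi (mderiv (1 : 'I_2) P).
Proof.
elim/(@mpoly_ring_ind F 0): P => [c|i|P Q IH IH'|P Q IH IH'].
- by rewrite to_biC derivC mderivC !rmorph0.
- rewrite to_biX mderivX mnm1E; case: (ord2P i) => ->.
    by rewrite scale0r rmorph0 derivC.
  rewrite scale1r derivX (_ : mnm_sub _ _ = mnm0) ?mpolyX0 ?rmorph1 ?polyC1 //.
  by apply/mnmP => l; rewrite mnmBE mnm0E subnn.
- by rewrite rmorphD derivD IH IH' mderivD rmorphD.
- by rewrite rmorphM derivM IH IH' mderivM rmorphD !rmorphM.
Qed.

Lemma derivx_to_bi P : derivx (to_bi P) = to_bi (mderiv (0 : 'I_2) P).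
Proof.
elim/(@mpoly_ring_ind F 0): P => [c|i|P Q IH IH'|P Q IH IH'].
- by rewrite to_biC derivxC derivC mderivC !rmorph0.
- rewrite to_biX mderivX mnm1E; case: (ord2P i) => ->; last first.
    by rewrite scale0r rmorph0 derivxX.
  rewrite scale1r derivxC derivX (_ : mnm_sub _ _ = mnm0) ?mpolyX0 ?rmorph1 ?polyC1 //.
  by apply/mnmP => l; rewrite mnmBE mnm0E subnn.
- by rewrite rmorphD derivxD IH IH' mderivD rmorphD.
- by rewrite rmorphM derivxM IH IH' mderivM rmorphD !rmorphM.
Qed.

Lemma bidegree_to_bi n P : (msize P <= n.+1)%N -> bidegree_le n (to_bi P).
Proof.
move=> sP; rewrite /to_bi /= /mmap big_seq; apply: bidegree_le_sum => m hm.
rewrite -[n]add0n; apply: bidegree_leM; first exact: bidegree_leC.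
apply: (@bidegree_leW _ (mdeg m)); first by have := leq_trans (msize_mdeg_lt hm) sP.
rewrite /mmap1 mdegE; elim/big_ind2: _ => [|n1 P1 n2 P2|i _]; [exact: (bidegree_leC 1)|exact: bidegree_leM|].
rewrite -[X in bidegree_le X]muln1; apply: bidegree_leX.
by rewrite /coord_xy; case: eqP => _; [exact: bidegree_le_x|exact: bidegree_leY].
Qed.

Lemma irreducible_to_bi P : irreducible_elt P -> irreducible_elt (to_bi P).
Proof.
case=> P0 uP irr; split.
- by apply: contra_neq P0 => h; rewrite -(to_biK P) h rmorph0.
- by apply: contra uP => h; rewrite -(to_biK P) rmorph_unit.
move=> b c E; have E' : P = of_bi b * of_bi c by rewrite -[LHS]to_biK E rmorphM.
have [ub|uc] := irr _ _ E'.
- by left; rewrite -(of_biK b) rmorph_unit.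
- by right; rewrite -(of_biK c) rmorph_unit.
Qed.

Lemma bidegree_exists G : exists M, bidegree_le M G.
Proof. by rewrite -(of_biK G); exists (msize (of_bi G)); apply: bidegree_to_bi; apply: leqnSn. Qed.

(** The Nullstellensatz for one irreducible equation, from the test points. *)
Lemma vanishing_divides (P G : {poly {poly F}}) : irreducible_elt P -> (1 < size P)%N ->
  (forall x y, eval2 P x y = 0 -> eval2 G x y = 0) -> divides P G.
Proof.
move=> irrP szP van; have [D bP] := bidegree_exists P; have [M bG] := bidegree_exists G.
by have [f hf] := test_points irrP szP bP; apply: (hf M) => // i hi _; apply: van.
Qed.

Lemma bidegree_leE n G : bidegree_le n G <-> (size G <= n.+1)%N /\ (size (swapXY G) <= n.+1)%N.
Proof.
rewrite -sizeYE; split=> -[h1 h2]; split => //.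
  by apply/bigmax_leqP => i _.
by move=> i; apply: leq_trans (max_size_coefXY _ _) h2.
Qed.

Lemma divides_bidegree n (P G : {poly {poly F}}) : divides P G -> G != 0 -> bidegree_le n G -> bidegree_le n P.
Proof.
move=> dPG G0 /bidegree_leE[h1 h2]; apply/bidegree_leE; split.
  exact: leq_trans (divides_size dPG G0) h1.
apply: leq_trans h2; apply: divides_size; last by rewrite swapXY_eq0.
by case: dPG => S ->; exists (swapXY S); rewrite rmorphM.
Qed.

End Conversion.
Arguments to_bi {F}.
Arguments of_bi {F}.

(** * From holomorphic graphs to distances between points *)

Section Tangency.
Variable R : realType.
Local Notation C := R[i].
Local Notation modulus := (@Normc.normc R).
Implicit Types (P : {poly {poly C}}) (g : set (plane R)) (p q : plane R).

(** The norm of [R[i]] has values in [R[i]]; the real [modulus] is the absolute value to which the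
    previous part applies. *)
Lemma normE (z : C) : `|z| = (modulus z)%:C%C.
Proof. by case: z. Qed.

Lemma modulusM (x y : C) : modulus (x * y) = modulus x * modulus y.
Proof. exact: Normc.normcM. Qed.

Lemma modulusD (x y : C) : modulus (x + y) <= modulus x + modulus y.
Proof. exact: le_normcD. Qed.

Lemma modulusN (x : C) : modulus (- x) = modulus x.
Proof. exact: normcN. Qed.

Lemma modulus0 : modulus 0 = 0.
Proof. exact: Normc.normc0. Qed.

Lemma modulus_eq0 (x : C) : modulus x = 0 -> x = 0.
Proof. exact: Normc.eq0_normc. Qed.

Lemma modulus_ge0 (x : C) : 0 <= modulus x.
Proof. exact: (abs_ge0 modulus0 modulusD modulusN). Qed.

Lemma modulusX (x : C) n : modulus (x ^+ n) = modulus x ^+ n.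
Proof. exact: (absX modulus_eq0 modulusM). Qed.

Definition equation P g := forall q, g q <-> eval2 P q.1 q.2 = 0.

Lemma rotation_inv (a b : C) : `|a| ^+ 2 + `|b| ^+ 2 = 1 -> forall p q,
  let u := (rotation a b q).1 - (rotation a b p).1 in
  let v := (rotation a b q).2 - (rotation a b p).2 in
  [/\ q.1 - p.1 = a^* * u + b^* * v, q.2 - p.2 = - b * u + a * v
    & u = a * (q.1 - p.1) - b^* * (q.2 - p.2)].
Proof.
rewrite !normCK => ab [x0 y0] [x y] /=; split; last by ring.
  have -> : a^* * (a * x - b^* * y - (a * x0 - b^* * y0)) + b^* * (b * x + a^* * y - (b * x0 + a^* * y0)) =
    (a * a^* + b * b^*) * (x - x0) by ring.
  by rewrite ab mul1r.
have -> : - b * (a * x - b^* * y - (a * x0 - b^* * y0)) + a * (b * x + a^* * y - (b * x0 + a^* * y0)) =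
    (a * a^* + b * b^*) * (y - y0) by ring.
by rewrite ab mul1r.
Qed.

(** Continuity of [h], a consequence of holomorphy, turns a statement on q near p into one on t near
    [p.1]. *)
Lemma local_graph_near g p (h : C^o -> C^o) :
    g p -> local_graph g p h ->
  p.2 = h p.1 /\ forall eta : C, 0 < eta ->
    \forall t \near p.1, g (t, h t) /\ `|h t - h p.1| < eta.
Proof.
move=> gp [hol lg]; have p2 : p.2 = h p.1 by apply/(nbhs_singleton lg).
have ch : {for p.1, continuous h}.
  apply: differentiable_continuous; apply/derivable1_diffP.
  exact: nbhs_singleton hol.
have cg A : nbhs (p.1, h p.1) A -> nbhs p.1 [set s | A (s, h s)].
  by move=> nA; apply: (@cvg_pair _ _ _ _ _ _ _ _ _ id h (@cvg_id _ _) ch A).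
have near_graph : \forall t \near p.1, g (t, h t).
  have lg' : nbhs (p.1, h p.1) [set q | g q <-> q.2 = h q.1] by rewrite -p2 -surjective_pairing.
  by apply: filterS (cg _ lg') => t [_]; apply.
split=> // eta eta0; near=> t; split; near: t; first exact: near_graph.
exact: (@cvgr_distC_lt _ _ _ _ _ _ _ ch _ eta0).
Unshelve. all: by end_near.
Qed.

(** The witnesses are the preimages of (t, h t) and (t, h' t), where t - [(r p).1] is a small real
    d. Their difference is the inverse rotation of (0, h t - h' t), and d is at most a constant
    times the distance from the first to p. *)
Lemma tangent_close k g g' p P P' : equation P g -> equation P' g' ->
  tangent k g g' p -> close modulus k P P' p.1 p.2.
Proof.
move=> gP g'P [[gp _] [g'p _] [a [b [ab _ _ [h [h' [lh lh' /eqO_exP[c c0 hO]]]]]]]].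
set r := rotation a b in lh lh' hO *.
have inv := rotation_inv ab; rewrite -/r in inv.
have rp : (r @` g) (r p) by exists p.
have rp' : (r @` g') (r p) by exists p.
have [p2 nh] := local_graph_near rp lh; have [p2' nh'] := local_graph_near rp' lh'.
(* [A] is the operator norm of the rotation and of its inverse, for the sum of the moduli of the
   coordinates. *)
pose A := modulus a + modulus b; pose c' := modulus c.
have cE : c = c'%:C%C by rewrite -normE gtr0_norm.
have c'0 : 0 <= c' by rewrite -lecR -cE ltW.
have A0 : 0 <= A by rewrite addr_ge0 ?modulus_ge0.
have modC (z : C) : modulus z^* = modulus z.
  by apply: complexI; rewrite -!normE norm_conjC.
have conj_le (z : C) : modulus (a^* * z) <= A * modulus z.
  by rewrite modulusM modC ler_wpM2r ?modulus_ge0 // lerDl modulus_ge0.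
exists (A * c' * A ^+ k.+1) => [|eps eps0]; first by rewrite !mulr_ge0 ?exprn_ge0.
pose eta := eps / (2 * A + 1).
have eta0 : 0 < eta by rewrite divr_gt0 //; lra.
have etaC : 0 < eta%:C%C by rewrite ltcR.
have [e e0 he] : exists2 e : C, 0 < e & forall t, `|t - (r p).1| < e ->
  [/\ (r @` g) (t, h t), (r @` g') (t, h' t), `|h t - h (r p).1| < eta%:C%C
    & `|h t - h' t| <= c * `|(t - (r p).1) ^+ k.+1|].
  have /nbhs_normP[e e0 he] : \forall t \near (r p).1,
     [/\ (r @` g) (t, h t), (r @` g') (t, h' t), `|h t - h (r p).1| < eta%:C%C
    & `|h t - h' t| <= c * `|(t - (r p).1) ^+ k.+1|].
    by near=> t; split; near: t; [apply: filterS (nh _ etaC) => t []|apply: filterS (nh' _ etaC) => t []|apply: filterS (nh _ etaC) => t []|].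
  by exists e => // t te; apply: he; rewrite /ball_ /= distrC.
have eR : e = (modulus e)%:C%C by rewrite -normE gtr0_norm.
have Re0 : 0 < modulus e by rewrite -ltcR -eR.
pose d := Num.min (modulus e) eta / 2.
have d0 : 0 < d by rewrite divr_gt0 // lt_min Re0.
have d_lt : d < modulus e /\ d < eta.
  have : Num.min (modulus e) eta <= modulus e by rewrite ge_min lexx.
  have : Num.min (modulus e) eta <= eta by rewrite ge_min lexx orbT.
  by rewrite /d; lra.
pose t : C := (r p).1 + d%:C%C.
have tu : t - (r p).1 = d%:C%C by rewrite /t addrAC subrr add0r.
have mt : modulus (t - (r p).1) = d.
  by apply: complexI; rewrite -normE tu ger0_norm // lecR ltW.
have [|[q gq rq] [q' g'q' rq'] h_eta h_k] := he t.
  by rewrite normE mt eR ltcR; case: d_lt.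
exists q.1, q.2, q'.1, q'.2.
have [i1 i2 i3] := inv p q; have [j1 j2 _] := inv q' q.
rewrite rq /= in i1 i2 i3; rewrite rq rq' /= subrr mulr0 add0r in j1.
rewrite rq rq' /= subrr mulr0 add0r in j2.
set m := modulus (q.1 - p.1) + modulus (q.2 - p.2).
have dm : d <= A * m.
  rewrite -mt i3 (le_trans (modulusD _ _)) // modulusN !modulusM modC /A /m.
  have := modulus_ge0 a; have := modulus_ge0 b.
  have := modulus_ge0 (q.1 - p.1); have := modulus_ge0 (q.2 - p.2); nra.
have hh : modulus (h t - h (r p).1) < eta by rewrite -ltcR -normE.
have mle : m <= A * (2 * eta).
  rewrite -[a * p.1 - _]/((r p).1) -[b * p.1 + _]/((r p).2) p2 in i1 i2.
  rewrite /m i1 i2.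
  have l1 := modulusD (a^* * (t - (r p).1)) (b^* * (h t - h (r p).1)).
  have l2 := modulusD (- b * (t - (r p).1)) (a * (h t - h (r p).1)).
  move: l1 l2; rewrite !modulusM modulusN !modC mt.
  have [_ d2] := d_lt; have := modulus_ge0 a; have := modulus_ge0 b.
  have := modulus_ge0 (h t - h (r p).1); rewrite /A; nra.
split; [by apply/gP|by apply/g'P| | |].
- rewrite lt_neqAle addr_ge0 ?modulus_ge0 // andbT; apply: contraTneq dm => <-.
  by rewrite mulr0 -ltNge.
- apply: le_lt_trans mle _; rewrite /eta mulrCA mulrA [2 * _]mulrC.
  by rewrite mulrA ltr_pdivrMr; nra.
have hdiff : modulus (h t - h' t) <= c' * d ^+ k.+1.
  by rewrite -lecR rmorphM /= -cE -normE -mt -modulusX -normE.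
rewrite j1 j2 !modulusM modC -mulrDl addrC -/A -!mulrA.
apply: ler_wpM2l => //; apply: le_trans hdiff _; apply: ler_wpM2l => //.
have Am0 : 0 <= A * m by exact: le_trans (ltW d0) dm.
by rewrite -exprMn; apply: lerXn2r; rewrite ?nnegrE // ltW.
Unshelve. all: by end_near.
Qed.

End Tangency.

(** * Irreducible equations and the list of all tangencies *)

Section Assembly.
Variable R : realType.
Local Notation C := R[i].
Implicit Types (P : {poly {poly C}}) (g : set (plane R)) (p q : plane R).

Definition zeros_of P : set (plane R) := [set q | eval2 P q.1 q.2 = 0].

Lemma equation_zeros_of P g : equation P g -> g = zeros_of P.
Proof. by move=> gP; apply/seteqP; split => q /gP. Qed.

Lemma equation_to_bi (Q : bipoly R) : equation (to_bi Q) (zeros Q).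
Proof. by move=> q; rewrite eval2_to_bi. Qed.

(** The reduced equation vanishes on the zeros of the irreducible one, hence is a multiple of it
    when y occurs, and passes on its degree bound. *)
Lemma curve_equation D g : irreducible_curve g -> curve_degree_le D g ->
  exists P, [/\ irreducible_elt P, equation P g & (1 < size P)%N -> bidegree_le D P].
Proof.
move=> [P0 irr0 gE] [Q [nQ _ gQ] sQ]; exists (to_bi P0); split.
- exact: irreducible_to_bi.
- by rewrite gE; apply: equation_to_bi.
move=> szP; apply: (divides_bidegree (G := to_bi Q)).
- apply: vanishing_divides szP _; first exact: irreducible_to_bi.
  move=> x y Px; have : g (x, y) by rewrite gE; apply/equation_to_bi.
  by rewrite gQ => /equation_to_bi.
- apply: contraPneq nQ => Q0; rewrite /nonconstant -(to_biK Q) Q0 rmorph0.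
  by rewrite mmeasure0.
exact: bidegree_to_bi.
Qed.

(** Smoothness is stated with some reduced equation, a multiple S P of [P]; at a zero of [P] its
    gradient is S times that of [P]. *)
Lemma smooth_gradient P g p : irreducible_elt P -> (1 < size P)%N -> equation P g ->
  smooth_at g p -> eval2 (derivx P) p.1 p.2 = 0 -> eval2 P^`() p.1 p.2 <> 0.
Proof.
move=> irrP szP gP [gp [Q [nQ _ gQ] grad]] Px Py; apply: grad.
have [S E] : divides P (to_bi Q).
  apply: vanishing_divides szP _ => // x y Pxy.
  have : g (x, y) by apply/gP.
  by rewrite gQ => /equation_to_bi.
have P0 : eval2 P p.1 p.2 = 0 by apply/gP.
rewrite /bieval -!/(coord_xy p.1 p.2) -!eval2_to_bi -derivx_to_bi -deriv_to_bi E.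
by rewrite derivxM derivM !eval2D !eval2M Px Py P0 !mulr0 !addr0.
Qed.

Lemma vertical_line P x0 y0 : irreducible_elt P -> (size P <= 1)%N -> eval2 P x0 y0 = 0 ->
  [/\ forall x y, eval2 P x y = 0 <-> x = x0, eval2 (derivx P) x0 y0 != 0 & P^`() = 0].
Proof.
move=> irrP /size1_polyC PE; rewrite PE eval2C => /eqP cx.
have /factor_theorem[c cE] := cx.
have PE' : P = c%:P * ('X - x0%:P)%:P by rewrite PE cE polyCM.
have [|] := irreducible_factor irrP PE'; last first.
  by rewrite poly_unitE => /andP[_]; rewrite coefC eqxx poly_unitE size_XsubC.
rewrite poly_unitE => /andP[_]; rewrite coefC eqxx poly_unitE => /andP[/eqP szc].
have [a cE'] : exists a, c = a%:P by exists c`_0; apply: size1_polyC; rewrite szc.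
rewrite cE' coefC eqxx unitfE => a0; split; last by rewrite derivC.
  move=> x y; rewrite eval2C cE cE' !hornerE; split=> [/eqP|->]; last by rewrite subrr mulr0.
  by rewrite mulf_eq0 (negbTE a0) subr_eq0 => /eqP.
by rewrite derivxC eval2C cE cE' deriv_mulC derivXsubC mulr1 hornerC.
Qed.

Section Cover.
Variables (k D d : nat) (CC : {fset set (plane R)}).
Hypothesis k_gt0 : (0 < k)%N.
Hypothesis curves : forall g, g \in CC -> irreducible_curve g /\ curve_degree_le D g.
Let M := ((1 + 2 * D * k) * (k.+2 * d))%N.
Hypothesis d_large : (#|` CC|%fset * (2 * (D * M) + D.+1) < d ^ k.+2)%N.

Lemma tangency_cover : exists2 L : seq (set (plane R) * plane R),
    (size L <= #|` CC|%fset * (2 * (2 * (D * M) * D) + 2 * (2 * (D * D) * D)))%N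
  & forall g g' p, g \in CC -> g' \in CC -> g' <> g -> tangent k g g' p -> (g, p) \in L.
Proof.
have /boolp.choice[pol polP] : forall g, exists P, g \in CC ->
    [/\ irreducible_elt P, equation P g & (1 < size P)%N -> bidegree_le D P].
  move=> g; have [gC|] := boolP (g \in CC); last by exists 0.
  by have [h1 h2] := curves gC; have [P hP] := curve_equation h1 h2; exists P.
pose s := [seq pol g | g <- enum_fset CC & (1 < size (pol g))%N].
have ss : (size s <= #|` CC|%fset)%N by rewrite size_map size_filter count_size.
have sP P : P \in s -> exists g, [/\ g \in CC, P = pol g & (1 < size (pol g))%N].
  by case/seq.mapP => g; rewrite mem_filter => /andP[szg gC] ->; exists g.
have Ps g : g \in CC -> (1 < size (pol g))%N -> pol g \in s.
  by move=> gC szg; apply: map_f; rewrite mem_filter szg.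
have pol_inj g g' : g \in CC -> g' \in CC -> pol g = pol g' -> g = g'.
  move=> gC g'C e; have [_ gP _] := polP g gC; have [_ g'P _] := polP g' g'C.
  by rewrite (equation_zeros_of gP) (equation_zeros_of g'P) e.
have adm : admissible D s.
  move=> P /sP[g [gC -> szg]]; have [irr gP /(_ szg) bd] := polP g gC; split=> //.
  move=> P' /sP[g' [g'C -> szg']] ne [S E]; apply: ne; congr pol.
  have [irr' g'P _] := polP g' g'C.
  have [uS|uP] := irreducible_factor irr' E; last by case: irr => _ /negP.
  rewrite (equation_zeros_of gP) (equation_zeros_of g'P); apply/seteqP; split => q.
    rewrite /zeros_of /= => h; have : eval2 (S^-1 * pol g') q.1 q.2 = 0 by rewrite eval2M h mulr0.
    by rewrite E mulKr.
  by rewrite /zeros_of /= => h; rewrite E eval2M h mulr0.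
have [|L1 sL1 hL1] := contacts_cover k_gt0 adm (d := d).
  by apply: leq_ltn_trans d_large; rewrite leq_mul2r ss orbT.
have /boolp.choice[V hV] : forall P, exists V : seq (C * C), P \in s ->
    (size V <= 2 * (D * D) * D)%N /\
    forall x y, eval2 P x y = 0 -> eval2 P^`() x y = 0 -> (x, y) \in V.
  move=> P; have [Pin|] := boolP (P \in s); last by exists [::].
  by have [h1 h2 h3 _] := adm P Pin; have [V h4 h5] := vertical_points h1 h2 h3; exists V.
pose spread (f : {poly {poly C}} -> plane R -> set (plane R)) :=
  flatten [seq [seq (f P v, (v : plane R)) | v <- V P] | P <- s].
have size_spread f : (size (spread f) <= #|` CC|%fset * (2 * (D * D) * D))%N.
  apply: leq_trans (leq_mul ss (leqnn _)); rewrite /spread.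
  have : forall P, P \in s -> (size (V P) <= 2 * (D * D) * D)%N by move=> P /hV[].
  elim: (s) => //= P s' IH hs; rewrite size_cat size_map mulSn leq_add //; first by rewrite hs // mem_head.
  by apply: IH => P' P's; apply: hs; rewrite in_cons P's orbT.
have in_spread f P p : P \in s -> eval2 P p.1 p.2 = 0 -> eval2 P^`() p.1 p.2 = 0 -> (f P p, p) \in spread f.
  move=> Pin h1 h2; apply/flatten_mapP; exists P => //.
  have pV : (p.1, p.2) \in V P by apply: (hV P Pin).2.
  by rewrite -surjective_pairing in pV; apply: (map_f (fun v : plane R => (f P v, v)) pV).
(* Besides the contacts, each vertical point v of a curve gives two pairs: the curve itself and the
   vertical line through v. A vertical line touches another curve only at vertical points of the
   latter. *)
exists ([seq (zeros_of w.1, (w.2 : plane R)) | w <- L1] ++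
        spread (fun P _ => zeros_of P) ++ spread (fun _ v => [set q | q.1 = v.1])).
  rewrite !size_cat size_map mulnDr; apply: leq_add.
    by apply: leq_trans sL1 _; rewrite leq_mul2r ss orbT.
  by rewrite mul2n -addnn mulnDr; apply: leq_add; apply: size_spread.
move=> g g' p gC g'C ne tan.
have [irr gP _] := polP g gC; have [irr' g'P _] := polP g' g'C.
have [[gp _] sm' _] := tan; have g'p := sm'.1.
have Pp : eval2 (pol g) p.1 p.2 = 0 by apply/gP.
have P'p : eval2 (pol g') p.1 p.2 = 0 by apply/g'P.
have cl := tangent_close gP g'P tan.
(* With parallel gradients and smoothness, the two tangents at p are vertical together or not at
   all; this settles the mixed cases below. *)
have par := close_gradients (modulus0 R) (@modulus_eq0 R) (@modulusM R) (@modulusD R)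
  (@modulusN R) k_gt0 Pp P'p cl.
rewrite !mem_cat (equation_zeros_of gP).
have [szP|szP] := ltnP 1 (size (pol g)); last first.
  have [line Px Py0] := vertical_line irr szP Pp.
  apply/orP; right; apply/orP; right.
  have szP' : (1 < size (pol g'))%N.
    rewrite ltnNge; apply/negP => szP'; apply: ne.
    have [line' _ _] := vertical_line irr' szP' P'p.
    rewrite (equation_zeros_of gP) (equation_zeros_of g'P); apply/seteqP.
    by split=> q; rewrite /zeros_of /=; [move=> /line' h; exact/line|move=> /line h; exact/line'].
  have P'y : eval2 (pol g')^`() p.1 p.2 = 0.
    move/eqP: par; rewrite Py0 eval2_0 mul0r mulf_eq0 (negbTE Px) /= => /eqP.
    by [].
  have -> : zeros_of (pol g) = [set q | q.1 = p.1].
    by apply/seteqP; split => q; rewrite /zeros_of /= => /line.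
  exact: (in_spread (fun _ v => [set q | q.1 = v.1]) (pol g') p (Ps _ g'C szP') P'p P'y).
have Pin := Ps g gC szP.
have [Py|Py] := eqVneq (eval2 (pol g)^`() p.1 p.2) 0.
  by rewrite (in_spread (fun P _ => zeros_of P)) ?orbT.
have szP' : (1 < size (pol g'))%N.
  rewrite ltnNge; apply/negP => szP'.
  have [_ P'x P'y0] := vertical_line irr' szP' P'p.
  move/esym/eqP: par; rewrite P'y0 eval2_0 mulr0 mulf_eq0.
  by rewrite (negbTE Py) (negbTE P'x).
have P'y : eval2 (pol g')^`() p.1 p.2 != 0.
  apply/eqP => P'y; have P'x : eval2 (derivx (pol g')) p.1 p.2 = 0.
    by move/esym/eqP: par; rewrite P'y mulr0 mulf_eq0 (negbTE Py) => /eqP.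
  exact: smooth_gradient irr' szP' g'P sm' P'x P'y.
have ct := close_contact (modulus0 R) (@modulus_eq0 R) (@modulusM R) (@modulusD R)
  (@modulusN R) Pp P'p Py P'y cl.
have : (pol g, (p.1, p.2)) \in L1.
  by apply: hL1 ct; [exact: Pin|exact: Ps|move=> e; apply: ne; apply: pol_inj].
by move/(map_f (fun w => (zeros_of w.1, (w.2 : plane R)))); rewrite /= -surjective_pairing => ->.
Qed.

End Cover.
End Assembly.

(** Double counting: the sum is a supremum of finite sums, and in each of them an entry of [L]
    counts only through the one point it carries. *)
Lemma esum_tangency_le (R : realType) k (C : {fset set (plane R)}) (L : seq (set (plane R) * plane R)) :
  (forall g g' p, g \in C -> g' \in C -> g' <> g -> tangent k g g' p -> (g, p) \in L) ->
  (\esum_(p in [set: plane R]) ((tangency_count k C p)%:R : R)%:E <= ((size L)%:R)%:E)%E.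
Proof.
move=> hL; apply: ge_ereal_sup => _ [A [finA _] <-].
rewrite fsbig_finite // sumEFin lee_fin -natr_sum ler_nat.
have count_le p : (tangency_count k C p <= count (fun w => w.2 == p) L)%N.
  rewrite -size_filter -(size_map fst); apply: uniq_leq_size; first exact: fset_uniq.
  move=> g; rewrite !inE /= => /andP[gC /asboolP[g' [g'C ne tan]]].
  by apply/seq.mapP; exists (g, p) => //; rewrite mem_filter eqxx (hL g g').
apply: (@leq_trans (\sum_(p <- fset_set A) count (fun w => w.2 == p) L)%N).
  by apply: leq_sum => p _; exact: count_le.
have -> : (\sum_(p <- fset_set A) count (fun w => w.2 == p) L =
  \sum_(w <- L) \sum_(p <- fset_set A) (w.2 == p))%N.
  by rewrite exchange_big /=; apply: eq_bigr => p _; rewrite -sum1_count big_mkcond.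
rewrite -[size L]sum1_size; apply: leq_sum => w _.
rewrite (eq_bigr (fun p => (if p == w.2 then 1 else 0)%N)) => [|p _].
  by rewrite -big_mkcond /= sum1_count count_uniq_mem ?fset_uniq ?leq_b1.
by rewrite eq_sym; case: (_ == _).
Qed.

Theorem theorem3 (R : realType) (k D : nat) (hk : (1 <= k)%N) (hD : (1 <= D)%N) :
  exists K : R, forall (n : nat) (C : {fset set (plane R)}),
    #|` C|%fset = n ->
    (forall g : set (plane R), g \in C ->
       irreducible_curve g /\ curve_degree_le D g) ->
    (\esum_(p in [set: plane R]) ((tangency_count k C p)%:R)%:E
      <= (K * n%:R `^ ((k%:R + 2) / (k%:R + 1)))%:E)%E.
Proof.
(* Pullbacks have bidegree at most e d; a curve then imposes at most c d conditions and accounts for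
   at most c' d pairs. *)
pose e := ((1 + 2 * D * k) * k.+2)%N.
pose c := (2 * (D * e) + D.+1)%N; pose c' := (4 * (D * e * D) + 4 * (D * D * D))%N.
exists (2 * (c' * c)%:R) => n C Cn curves.
(* The requirement is n c d < d^(k+2). As n < (t + 1)^(k+1), the factor c in [d] absorbs the
   constant. *)
pose x : R := n%:R `^ (k.+1%:R)^-1; pose t := Num.truncn x; pose d := (c * t.+1)%N.
have x0 : 0 <= x by exact: powR_ge0.
have xt : x < t.+1%:R by case/andP: (truncn_itv x0).
have tx : t%:R <= x by case/andP: (truncn_itv x0).
have xn : x ^+ k.+1 = n%:R by rewrite -powR_mulrn // -powRrM mulVf ?powRr1.
have nt : (n < t.+1 ^ k.+1)%N.
  by rewrite -(ltr_nat R) natrX -xn; apply: ltrXn2r.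
have c0 : (0 < c)%N by rewrite /c; lia.
have d0 : (0 < d)%N by rewrite muln_gt0 c0.
have d_large : (#|` C|%fset * (2 * (D * ((1 + 2 * D * k) * (k.+2 * d))) + D.+1) < d ^ k.+2)%N.
  rewrite Cn; apply: (@leq_ltn_trans (n * c * d)%N).
    by rewrite -[leqRHS]mulnA leq_mul2l /c /e; apply/orP; right; nia.
  rewrite expnSr ltn_pmul2r // /d expnMn mulnC.
  apply: (@leq_trans (c * t.+1 ^ k.+1)%N); first by rewrite ltn_pmul2l.
  by apply: leq_mul => //; rewrite expnS leq_pmulr // expn_gt0 c0.
have [L sL hL] := tangency_cover hk curves d_large.
apply: le_trans (esum_tangency_le hL) _; rewrite lee_fin.
have sL' : (size L <= n * (c' * (c * t.+1)))%N.
  apply: leq_trans sL _; rewrite Cn leq_mul2l -/d /c' /e; apply/orP; right; nia.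
apply: le_trans (_ : (n * (c' * (c * t.+1)))%:R <= _); first by rewrite ler_nat.
(* For n > 0 one has x >= 1, hence t + 1 <= 2 x: the origin of the 2 in the constant. *)
have [->|n0] := posnP n; first by rewrite mul0n mulr_ge0 ?powR_ge0 // mulr_ge0.
have n1 : 1 <= n%:R :> R by rewrite ler1n.
have x1 : 1 <= x by rewrite -(powRr0 n%:R); apply: ler_powR; rewrite // invr_ge0.
have -> : (k%:R + 2) / (k%:R + 1) = 1 + (k.+1%:R)^-1 :> R.
  have : k.+1%:R != 0 :> R by [].
  by rewrite -natr1 => k0; field.
rewrite powRD; last by rewrite gt_eqF // addr_gt0 // invr_gt0.
rewrite powRr1 // -/x !natrM.
have -> : 2 * (c'%:R * c%:R) * (n%:R * x) = n%:R * (c'%:R * (c%:R * (2 * x))) :> R by ring.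
do 3 (apply: ler_wpM2l => //).
by rewrite -natr1; lra.
Qed.
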